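(* $\Delta_n(1+x+y)\overset{*}{\sim}\sum_{r=2}^{\infty}c_r(n)/n^r$, for $$c_r(n)=\frac{2}{\pi}\sum_{\substack{a,b\\ a+b=r+1}}(-1)^b\,\mathfrak{R}_a\bigl(\mathrm{Li}_a(\xi^{n+1})\bigr)\sum_{j=b}^{r-1}\genfrac{[}{]}{0pt}{}{j}{b}\genfrac{\{}{\}}{0pt}{}{r-1}{j}\,\mathfrak{R}_{a+1}(\xi^j),$$ where $\genfrac{[}{]}{0pt}{}{a}{b}$ and $\genfrac{\{}{\}}{0pt}{}{a}{b}$ represent the (unsigned) Stirling numbers of the first and second kind, respectively, and $\xi=\exp(2\pi i/3)$. In particular, the coefficients $c_r(n)$ are linear combinations of polylogarithms evaluated at third roots of unity, with coefficients in $\frac{1}{2\pi}\mathbb{Z}[\sqrt3]$.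
   Context: For a nonzero Laurent polynomial $P$ in $k$ variables over $\mathbb{C}$, the (logarithmic) Mahler measure is $m(P)=\int_0^1\cdots\int_0^1\log|P(e^{2\pi i t_1},\dots,e^{2\pi i t_k})|\,dt_1\cdots dt_k$. For a nonzero Laurent polynomial $P(x,y)$ and a positive integer $n$, $\Delta_n(P)=m(P(x,x^n))-m(P(x,y))$. $\mathbb{N}$ is the set of positive integers. A function $\omega:\mathbb{R}\to\mathbb{R}$ is quasiperiodic if it is a sum of finitely many continuous, periodic functions. For $f:\mathbb{N}\to\mathbb{R}$, $f(n)\overset{*}{\sim}\sum_{r\ge0}c_r(n)/n^r$ (an asymptotic pseudo-power series expansion) means that each $c_r(n)$ is the restriction to the nonnegative integers of a quasiperiodic function, and that for all positive integers $n$ and $k$, $f(n)=\sum_{r=0}^{k-1}c_r(n)/n^r+O_{f,k}(1/n^k)$, where the implied constant depends only on $f$ and $k$. A series starting at $r=2$ means $c_0=c_1=0$. $\mathrm{Li}_k$ is the principal branch of the $k$-th polylogarithm; for $k\ge2$ and $|z|\le1$, $\mathrm{Li}_k(z)=\sum_{j\ge1}z^j/j^k$. $\mathfrak{R}_a(z)=\mathrm{Re}(z)$ if $a$ is even and $\mathrm{Im}(z)$ if $a$ is odd. The Stirling numbers with indices $n$ (upper) and $k$ (lower) equal $1$ for $n=k=0$ and are otherwise zero unless $1\le k\le n$. In the outer sum $a,b$ are integers; the inner sum vanishes unless $2\le a\le r$, so only those terms contribute. *)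

(* Defs.v *)
From HB Require Import structures.
From mathcomp Require Import all_boot all_order all_algebra finmap.
From mathcomp Require Import all_classical all_reals all_analysis.
From mathcomp.real_closed Require Import complex.
Set Implicit Arguments.
Unset Strict Implicit.
Unset Printing Implicit Defensive.
Import Order.TTheory GRing.Theory Num.Theory.
Import numFieldNormedType.Exports.
Local Open Scope classical_set_scope.
Local Open Scope ring_scope.
Local Open Scope complex_scope.

(* A Laurent polynomial in k variables over C = R[i], given by its finitely
   supported coefficients indexed by exponent vectors in Z^k. *)
Definition laurent (R : realType) (k : nat) : Type :=
  {fsfun k.-tuple int -> R[i] with 0}.

Definition laurent_eval (R : realType) (k : nat) (P : laurent R k)
    (z : k.-tuple R[i]) : R[i] :=
  \sum_(e <- finsupp P) P e * \prod_(i < k) tnth z i ^ tnth e i.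

Definition expi (R : realType) (t : R) : R[i] := cos t +i* sin t.

(* Iterated Lebesgue integral over the unit cube [0, 1]^k. *)
Fixpoint cube_integral (R : realType) (k : nat) : (k.-tuple R -> R) -> R :=
  match k with
  | 0 => fun f => f [tuple]
  | k'.+1 => fun f =>
      \int[lebesgue_measure]_(t in `[0, 1])
        cube_integral (fun s : k'.-tuple R => f [tuple of t :: s])
  end.

(* For P != 0 the zeros of P on the torus form a null set, so the convention
   ln 0 = 0 does not affect the value. *)
Definition mahler (R : realType) (k : nat) (P : laurent R k) : R :=
  cube_integral (fun t : k.-tuple R =>
    ln (Normc.normc (laurent_eval P [tuple of map (fun s => expi (2 * pi * s)) t]))).

Definition subst_exponent (n : nat) (e : 2.-tuple int) : 1.-tuple int :=
  [tuple tnth e ord0 + n%:Z * tnth e ord_max].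

(* P(x, x^n), collecting the terms that acquire the same exponent. *)
Definition laurent_subst (R : realType) (n : nat) (P : laurent R 2) :
    laurent R 1 :=
  [fsfun m in [fset subst_exponent n e | e in finsupp P]%fset =>
     \sum_(e <- finsupp P | subst_exponent n e == m) P e].

Definition Delta (R : realType) (P : laurent R 2) (n : nat) : R :=
  mahler (laurent_subst n P) - mahler P.

Definition one_x_y (R : realType) : laurent R 2 :=
  [fsfun e in [fset [tuple 0; 0]; [tuple 1; 0]; [tuple 0; 1]]%fset => 1].

Definition quasiperiodic (R : realType) (w : R -> R) : Prop :=
  exists (m : nat) (g : 'I_m -> R -> R),
    (forall i, continuous (g i) /\ exists2 T : R, 0 < T & periodic (g i) T) /\
    (forall x, w x = \sum_(i < m) g i x).

(* f(n) ~* sum_{r >= 0} c_r(n) / n^r.  The coefficient c_r(n) is [c r n]; f is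
   only constrained at positive n. *)
Definition pseudo_expansion (R : realType) (f : nat -> R)
    (c : nat -> nat -> R) : Prop :=
  (forall r, exists2 w : R -> R, quasiperiodic w & forall n, c r n = w n%:R) /\
  (forall k : nat, (0 < k)%N -> exists K : R, forall n : nat, (0 < n)%N ->
     `| f n - \sum_(r < k) c r n / n%:R ^+ r | <= K / n%:R ^+ k).

(* Unsigned, number of permutations of n points with k cycles. *)
Fixpoint stirling1 (n k : nat) : nat :=
  match n, k with
  | 0, 0 => 1
  | 0, _.+1 => 0
  | _.+1, 0 => 0
  | n'.+1, k'.+1 => n' * stirling1 n' k'.+1 + stirling1 n' k'
  end.

(* Number of partitions of n points into k nonempty blocks. *)
Fixpoint stirling2 (n k : nat) : nat :=
  match n, k with
  | 0, 0 => 1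
  | 0, _.+1 => 0
  | _.+1, 0 => 0
  | n'.+1, k'.+1 => k'.+1 * stirling2 n' k'.+1 + stirling2 n' k'
  end.

(* Li_k(z) on the domain k >= 2, |z| <= 1, where the principal branch is given
   by the power series; used only there. *)
Definition polylog (R : realType) (k : nat) (z : R[i]) : R[i] :=
  limn (series (fun j : nat => z ^+ j.+1 / j.+1%:R ^+ k : R[i]^o)).

Definition reim (R : realType) (a : nat) (z : R[i]) : R :=
  if odd a then complex.Im z else complex.Re z.

Definition xi3 (R : realType) : R[i] := expi (2 * pi / 3).

(* The sum over integers a + b = r + 1, written with b = r + 1 - a and
   restricted to 2 <= a <= r, outside of which the inner sum vanishes. *)
Definition coef1xy (R : realType) (r n : nat) : R :=
  2 / pi * \sum_(2 <= a < r.+1)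
    let b := (r.+1 - a)%N in
    (-1) ^+ b * reim a (polylog a (xi3 R ^+ n.+1)) *
    \sum_(b <= j < r)
      (stirling1 j b)%:R * (stirling2 r.-1 j)%:R * reim a.+1 (xi3 R ^+ j).

(* q belongs to (1 / (2 pi)) Z[sqrt 3] *)
Definition in_Zsqrt3_over_2pi (R : realType) (q : R) : Prop :=
  exists u v : int, q = (u%:~R + v%:~R * Num.sqrt 3) / (2 * pi).

(* Linear combination, with coefficients in (1 / (2 pi)) Z[sqrt 3], of the real
   numbers reim a (Li_a(z)) with a >= 2 and z^3 = 1.  Real and imaginary parts
   of the polylogarithms are meant, as for coef1xy: the value is real, and for
   odd a it is Im (Li_a(z)) that occurs.  A term of the combination is a triple
   (coefficient, a, z). *)
Definition polylog_combination (R : realType) (x : R) : Prop :=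
  exists2 s : seq (R * nat * R[i]),
    (forall q a z, (q, a, z) \in s ->
       [/\ in_Zsqrt3_over_2pi q, (2 <= a)%N & z ^+ 3 = 1]) &
    x = \sum_(t <- s) t.1.1 * reim t.1.2 (polylog t.1.2 t.2).

(* Main.v *)
Require Import Defs.
From HB Require Import structures.
From mathcomp Require Import all_boot all_order all_algebra finmap.
From mathcomp Require Import all_classical all_reals all_analysis measurable_realfun.
From mathcomp.real_closed Require Import complex.
From mathcomp Require Import ring lra.
Import Order.TTheory GRing.Theory Num.Theory.
Import numFieldNormedType.Exports.
Local Open Scope ring_scope.
Set Implicit Arguments.
Unset Strict Implicit.
Unset Printing Implicit Defensive.
Local Open Scope classical_set_scope.
Local Open Scope complex_scope.
Import Normc.
Local Notation Re := complex.Re.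
Local Notation Im := complex.Im.

(** Let [e(t) = exp(2 i pi t)] and let [xi = e(1/3)]. On the unit circle the
   modulus of [1 + x] is at least one on the long arc from [conj xi] to [xi]
   through one, and at most one on the short arc through [-1]. Jensen's
   formula in [y] gives [m(1 + x + y)] as the integral of the positive part of
   [ln |1 + x|]. Subtracting it from [m(1 + x + x^n)] leaves the integral of
   [ln |1 + z|], where [z = x^n / (1 + x)] on the long arc and, up to
   conjugation, [z = x^(n-1) (1 + x)] on the short one, so that [|z| <= 1].

   Expanding the logarithm ([integral_ln_series]) turns the difference into a
   series over [k] of the integrals of [Re (z ^ k)]. Each of these is a contour
   integral of a rational function with real coefficients, and is given by the
   value at [xi] of the imaginary part of a primitive ([integral_arc],
   [primitive_ratfrac], [primitive_poly], [Delta_series]). That same value is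
   also the increment of the primitive along the ray from [0] to [xi]: the
   oscillating integral has been replaced by one whose integrand decays like
   the power [(n - 1) k] of the radius.

   Along the ray, [M] integrations by parts with respect to the factor
   [x^(n k)] produce an expansion in powers of [1 / (n k)] whose remainder is
   [O(1 / (n^(M+1) k))] uniformly in [k] ([Im_primitive_fpow],
   [Im_primitive_gpow]). The operator that is iterated is [x d/dx], acting on
   powers of [1 + x]; this is where the Stirling numbers of the second kind
   come from, and those of the first kind appear when the factorials that
   result are expanded in powers of [k] ([fiter_xi3], [giter_xi3],
   [rising_stirling1]). A power [k^b], divided by [k (n k)^r] and summed over
   [k] against [xi^((n+1) k)], gives a polylogarithm of order
   [a = r + 1 - b] at [xi^(n+1)], and the two arcs combine into the product of
   real or imaginary parts in the statement ([Im_reim]). The remainders, still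
   divided by [k], sum to [O(1 / n^(M+1))] ([Delta_rate]).

   The coefficients depend on [n] only through its residue modulo three,
   whence quasiperiodicity, and the powers of [xi] have real and imaginary
   parts in [(1/2) Z[sqrt 3]]. *)

(** * Differentiation along paths *)

Section PathDerivative.
Context {R : realType}.
Local Notation C := R[i].
Implicit Types (f g : R -> C) (t : R) (D : C -> Prop) (F G : C -> C).

Lemma complexP (x y : C) : Re x = Re y -> Im x = Im y -> x = y.
Proof. by case: x y => [a b] [c d] /= -> ->. Qed.

Lemma ReD (x y : C) : Re (x + y) = Re x + Re y.
Proof. by case: x y => [a b] [c d]. Qed.

Lemma ImD (x y : C) : Im (x + y) = Im x + Im y.
Proof. by case: x y => [a b] [c d]. Qed.

Lemma ReN (x : C) : Re (- x) = - Re x.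
Proof. by case: x. Qed.

Lemma ImN (x : C) : Im (- x) = - Im x.
Proof. by case: x. Qed.

Lemma ReM (x y : C) : Re (x * y) = Re x * Re y - Im x * Im y.
Proof. by case: x y => [a b] [c d]. Qed.

Lemma ImM (x y : C) : Im (x * y) = Re x * Im y + Im x * Re y.
Proof. by case: x y => [a b] [c d]. Qed.

Lemma ReV (x : C) : Re x^-1 = Re x / (Re x ^+ 2 + Im x ^+ 2).
Proof. by case: x. Qed.

Lemma ImV (x : C) : Im x^-1 = - (Im x / (Re x ^+ 2 + Im x ^+ 2)).
Proof. by case: x. Qed.

Lemma sqr_normc_gt0 (x : C) : x != 0 -> 0 < Re x ^+ 2 + Im x ^+ 2.
Proof.
case: x => a b; rewrite eq_complex /= negb_and => /orP[] h.
- by rewrite ltr_pwDl// ?sqr_ge0// exprn_even_gt0.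
- by rewrite ltr_wpDl// ?sqr_ge0// exprn_even_gt0.
Qed.

Definition cderive f t (l : C) : Prop :=
  is_derive t 1 (fun u => Re (f u)) (Re l) /\
  is_derive t 1 (fun u => Im (f u)) (Im l).

Lemma cderive_eq f t l l' : cderive f t l -> l = l' -> cderive f t l'.
Proof. by move=> ? <-. Qed.

Lemma cderive_cst (c : C) t : cderive (fun=> c) t 0.
Proof. by split; apply: is_derive_cst. Qed.

Lemma cderiveD f g t l m : cderive f t l -> cderive g t m ->
  cderive (fun u => f u + g u) t (l + m).
Proof.
move=> [f1 f2] [g1 g2]; split.
- under eq_fun do rewrite ReD.
  by rewrite ReD; exact: is_deriveD.
- under eq_fun do rewrite ImD.
  by rewrite ImD; exact: is_deriveD.
Qed.

Lemma cderiveM f g t l m : cderive f t l -> cderive g t m ->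
  cderive (fun u => f u * g u) t (l * g t + f t * m).
Proof.
move=> [f1 f2] [g1 g2]; split.
- under eq_fun do rewrite ReM.
  apply: (@is_derive_eq _ _ _ _ _ _ _ _ (is_deriveB (is_deriveM f1 g1) (is_deriveM f2 g2))).
  by rewrite !(ReD, ReM)/GRing.scale/=; ring.
- under eq_fun do rewrite ImM.
  apply: (@is_derive_eq _ _ _ _ _ _ _ _ (is_deriveD (is_deriveM f1 g2) (is_deriveM f2 g1))).
  by rewrite !(ImD, ImM)/GRing.scale/=; ring.
Qed.

Lemma is_derive_sqrD f t l : cderive f t l ->
  is_derive t 1 (fun u => Re (f u) ^+ 2 + Im (f u) ^+ 2)
    (2 * (Re (f t) * Re l + Im (f t) * Im l)).
Proof.
move=> [f1 f2].
apply: (@is_derive_eq _ _ _ _ _ _ _ _ (is_deriveD (is_deriveX 2 f1) (is_deriveX 2 f2))).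
by rewrite /GRing.scale/=; ring.
Qed.

Lemma cderiveV f t l : f t != 0 -> cderive f t l ->
  cderive (fun u => (f u)^-1) t (- l * (f t)^-1 ^+ 2).
Proof.
move=> ft0 fl; have [f1 f2] := fl.
have n0 := sqr_normc_gt0 ft0; have n1 := lt0r_neq0 n0.
have dn := @is_deriveV _ (fun u => Re (f u) ^+ 2 + Im (f u) ^+ 2) _ _ _ n1
  (is_derive_sqrD fl).
split.
- under eq_fun do rewrite ReV.
  apply: (@is_derive_eq _ _ _ _ _ _ _ _ (is_deriveM f1 dn)).
  rewrite /GRing.scale/= !(ReM, ReN, ImM, ImN, ReV, ImV).
  by field.
- under eq_fun do rewrite ImV.
  apply: (@is_derive_eq _ _ _ _ _ _ _ _ (is_deriveN (is_deriveM f2 dn))).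
  rewrite /GRing.scale/= !(ReM, ReN, ImM, ImN, ReV, ImV).
  by field.
Qed.

Lemma cderive_continuous f t l : cderive f t l ->
  {for t, continuous (fun u => Re (f u))} /\ {for t, continuous (fun u => Im (f u))}.
Proof.
by move=> [[h1 _] [h2 _]]; split; apply: differentiable_continuous;
  apply/derivable1_diffP.
Qed.

(** Principal logarithm on the half-plane [Re z > 0]. *)
Definition clog (z : C) : C := ln (normc z) +i* atan (Im z / Re z).

Lemma normc_sqrt (z : C) : normc z = Num.sqrt (Re z ^+ 2 + Im z ^+ 2).
Proof. by case: z. Qed.

Lemma cderive_clog f t l : 0 < Re (f t) -> cderive f t l ->
  cderive (fun u => clog (f u)) t ((f t)^-1 * l).
Proof.
move=> ft0 fl; have [f1 f2] := fl.
have fn0 : f t != 0 by rewrite eq_complex /= negb_and gt_eqF.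
have n0 := sqr_normc_gt0 fn0; have n1 := lt0r_neq0 n0.
have r1 := lt0r_neq0 ft0.
split.
- have -> : (fun u => Re (clog (f u))) = (fun u => ln (Num.sqrt (Re (f u) ^+ 2 + Im (f u) ^+ 2))).
    by apply/funext => u /=; rewrite normc_sqrt.
  have s0 : 0 < Num.sqrt (Re (f t) ^+ 2 + Im (f t) ^+ 2) by rewrite sqrtr_gt0.
  have ds := @is_derive1_comp _ Num.sqrt
    (fun u => Re (f u) ^+ 2 + Im (f u) ^+ 2) t _ _
    (is_derive1_sqrt n0) (is_derive_sqrD fl).
  apply: (@is_derive_eq _ _ _ _ _ _ _ _ (@is_derive1_comp _ (@ln R)
    (fun u => Num.sqrt (Re (f u) ^+ 2 + Im (f u) ^+ 2)) t _ _
    (is_derive1_ln s0) ds)).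
  rewrite !(ReM, ReV, ImV) /GRing.scale/=.
  set s := Num.sqrt _ in s0 *.
  have ss : s ^+ 2 = Re (f t) ^+ 2 + Im (f t) ^+ 2 by rewrite sqr_sqrtr// ltW.
  rewrite -ss; have := lt0r_neq0 s0 => s1; field.
  by rewrite s1.
- apply: (@is_derive_eq _ _ _ _ _ _ _ _
    (@is_derive1_comp _ (@atan R) (fun u => Im (f u) / Re (f u)) t _ _
      (@is_derive1_atan _ _)
      (is_deriveM f2 (@is_deriveV _ (fun u => Re (f u)) _ _ _ r1 f1)))).
  rewrite !(ImM, ReV, ImV) /GRing.scale/=.
  field.
  by rewrite r1 n1.
Qed.

(** Complex differentiability on [D] in the form of the chain rule along real
   paths: this is what integration along arcs and rays uses, and it reduces
   every computation to real and imaginary parts. *)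
Definition holo D F (F' : C -> C) : Prop :=
  forall f t l, cderive f t l -> D (f t) ->
    cderive (fun u => F (f u)) t (F' (f t) * l).

Lemma holo_eq D F F' G' : (forall x, D x -> F' x = G' x) ->
  holo D F F' -> holo D F G'.
Proof. by move=> e h f t l fl Df; rewrite -e//; exact: h. Qed.

Lemma holo_ext D F F' G G' : (forall x, G x = F x) ->
  (forall x, D x -> G' x = F' x) -> holo D F F' -> holo D G G'.
Proof.
move=> /funext -> e; apply: holo_eq => x Dx; by rewrite e.
Qed.

Lemma holo_id D : holo D id (fun=> 1).
Proof. by move=> f t l fl _; rewrite mul1r. Qed.

Lemma holo_cst D c : holo D (fun=> c) (fun=> 0).
Proof. by move=> f t l fl _; rewrite mul0r; exact: cderive_cst. Qed.

Lemma holoD D F F' G G' : holo D F F' -> holo D G G' ->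
  holo D (fun x => F x + G x) (fun x => F' x + G' x).
Proof.
by move=> hF hG f t l fl Df; rewrite mulrDl; apply: cderiveD; [exact: hF|exact: hG].
Qed.

Lemma holoM D F F' G G' : holo D F F' -> holo D G G' ->
  holo D (fun x => F x * G x) (fun x => F' x * G x + F x * G' x).
Proof.
move=> hF hG f t l fl Df; apply: cderive_eq (cderiveM (hF _ _ _ fl Df) (hG _ _ _ fl Df)) _.
by ring.
Qed.

Lemma holoZ D F F' (c : C) : holo D F F' ->
  holo D (fun x => c * F x) (fun x => c * F' x).
Proof.
move=> hF; apply: holo_eq (holoM (@holo_cst D c) hF) => x _.
by rewrite mul0r add0r.
Qed.

Lemma holo_sum D (I : Type) (s : seq I) (F F' : I -> C -> C) :
  (forall i, holo D (F i) (F' i)) ->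
  holo D (fun x => \sum_(i <- s) F i x) (fun x => \sum_(i <- s) F' i x).
Proof.
move=> h; elim: s => [|i s IH].
- by apply: holo_ext (@holo_cst D 0) => [x|x _]; rewrite big_nil.
- by apply: holo_ext (holoD (h i) IH) => [x|x _]; rewrite big_cons.
Qed.

Lemma holoX D F F' n : holo D F F' ->
  holo D (fun x => F x ^+ n) (fun x => n%:R * F x ^+ n.-1 * F' x).
Proof.
move=> hF; elim: n => [|n IH].
  by apply: holo_eq (@holo_cst D 1) => x _; rewrite !mul0r.
apply: holo_ext (holoM hF IH) => [x|x _ /=]; first by rewrite exprS.
case: n {IH} => [|n] /=; first by rewrite !mul0r mulr0 expr0 addr0 !mulr1 mul1r.
by rewrite -[n.+2]addn1 natrD exprS; ring.
Qed.

Lemma holoV D F F' : (forall x, D x -> F x != 0) -> holo D F F' ->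
  holo D (fun x => (F x)^-1) (fun x => - F' x * (F x)^-1 ^+ 2).
Proof.
move=> F0 hF f t l fl Df; apply: cderive_eq (cderiveV (F0 _ Df) (hF _ _ _ fl Df)) _.
by ring.
Qed.

Lemma holo_clog D F F' : (forall x, D x -> 0 < Re (F x)) -> holo D F F' ->
  holo D (fun x => clog (F x)) (fun x => (F x)^-1 * F' x).
Proof.
move=> F0 hF f t l fl Df; apply: cderive_eq (cderive_clog (F0 _ Df) (hF _ _ _ fl Df)) _.
by ring.
Qed.

End PathDerivative.

(** * The Euler derivative, arcs and rays *)

Section Theta.
Context {R : realType}.
Local Notation C := R[i].
Implicit Types (D : C -> Prop) (F G H f g : C -> C).

(** [f] is the Euler derivative [x F'(x)] of [F]: the derivative along rays in
   the variable [log r] and, up to the factor [i], along circles in the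
   angle. *)
Definition theta D F f : Prop :=
  exists2 F', holo D F F' & forall x, D x -> x * F' x = f x.

Lemma theta_holo D F F' : holo D F F' -> theta D F (fun x => x * F' x).
Proof. by move=> hF; exists F'. Qed.

Lemma theta_eq D F f g : (forall x, D x -> f x = g x) ->
  theta D F f -> theta D F g.
Proof. by move=> e [F' hF hf]; exists F' => // x Dx; rewrite hf// e. Qed.

Lemma theta_ext D F G f : (forall x, G x = F x) -> theta D F f -> theta D G f.
Proof. by move=> /funext ->. Qed.

Lemma thetaD D F G f g : theta D F f -> theta D G g ->
  theta D (fun x => F x + G x) (fun x => f x + g x).
Proof.
move=> [F' hF hf] [G' hG hg]; exists (fun x => F' x + G' x); first exact: holoD.
by move=> x Dx; rewrite mulrDr hf ?hg.
Qed.

Lemma thetaZ D F f (c : C) : theta D F f ->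
  theta D (fun x => c * F x) (fun x => c * f x).
Proof.
move=> [F' hF hf]; exists (fun x => c * F' x); first exact: holoZ.
by move=> x Dx; rewrite mulrCA hf.
Qed.

Lemma theta_sum D (I : Type) (s : seq I) (F f : I -> C -> C) :
  (forall i, theta D (F i) (f i)) ->
  theta D (fun x => \sum_(i <- s) F i x) (fun x => \sum_(i <- s) f i x).
Proof.
move=> h.
have /choice[F' hF'] : forall i, exists F', holo D (F i) F' /\
    forall x, D x -> x * F' x = f i x.
  by move=> i; have [F' ? ?] := h i; exists F'.
exists (fun x => \sum_(i <- s) F' i x).
  by apply: holo_sum => i; have [] := hF' i.
by move=> x Dx; rewrite mulr_sumr; apply: eq_bigr => i _; have [_ ->] := hF' i.
Qed.

Lemma thetaM D F G f g : theta D F f -> theta D G g ->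
  theta D (fun x => F x * G x) (fun x => f x * G x + F x * g x).
Proof.
move=> [F' hF hf] [G' hG hg]; exists (fun x => F' x * G x + F x * G' x).
  exact: holoM.
by move=> x Dx; rewrite mulrDr -hf// -hg//; ring.
Qed.

Lemma thetaXn D p : theta D (fun x => x ^+ p) (fun x => p%:R * x ^+ p).
Proof.
exists (fun x => p%:R * x ^+ p.-1 * 1); first exact/holoX/holo_id.
by move=> x _; case: p => [|p]; rewrite ?mul0r ?mulr0// mulr1 mulrCA -exprS.
Qed.

Lemma holo_1D D : holo D (fun x => 1 + x) (fun=> 1).
Proof.
apply: holo_eq (holoD (@holo_cst R D 1) (@holo_id R D)) => x _.
by rewrite add0r.
Qed.

Lemma theta_1DXn D c : theta D (fun x => (1 + x) ^+ c)
  (fun x => c%:R * (1 + x) ^+ c - c%:R * (1 + x) ^+ c.-1).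
Proof.
apply: theta_eq (theta_holo (holoX c (@holo_1D D))) => x _ /=.
by case: c => [|c]; rewrite ?mul0r ?mulr0 ?subr0// exprS/=; ring.
Qed.

Lemma theta_1DVXn D c : (forall x, D x -> 1 + x != 0) ->
  theta D (fun x => (1 + x)^-1 ^+ c)
  (fun x => - c%:R * (x * (1 + x)^-1 ^+ c.+1)).
Proof.
move=> D0.
apply: theta_eq (theta_holo (holoX c (holoV D0 (@holo_1D D)))) => x Dx /=.
case: c => [|c]; first by rewrite oppr0 !mul0r mulr0.
by rewrite /= [_ ^+ c.+2]exprS [_ ^+ c.+1]exprS; ring.
Qed.

(** ** Primitives of the two integrands *)

(** Schwarz reflection, which holds for functions with real coefficients. It
   makes [F] real on the real axis, so that the endpoints [0], [1] of the paths
   used below do not contribute to imaginary parts. *)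
Definition csym F := forall x : C, F (conjc x) = conjc (F x).

Lemma csym_Im0 F x : csym F -> Im x = 0 -> Im (F x) = 0.
Proof.
move=> sF x0; have e : conjc x = x by case: x x0 => a b /= ->; rewrite oppr0.
have := sF x; rewrite e; case: (F x) => a b [] /= h; lra.
Qed.

Definition half_plane : C -> Prop := fun x => 0 < Re (1 + x).
Definition whole_plane : C -> Prop := fun=> True.

Lemma half_plane_neq0 x : half_plane x -> 1 + x != 0.
Proof. by rewrite /half_plane => h; apply/eqP => e; rewrite e /= ltxx in h. Qed.

Lemma primitive_Xn D (p : nat) :
  exists2 F, holo D F (fun x => x ^+ p) & csym F.
Proof.
exists (fun x => p.+1%:R^-1 * x ^+ p.+1).
  apply: holo_eq (holoZ _ (holoX p.+1 (@holo_id R D))) => x _ /=.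
  by rewrite mulr1 mulKf// pnatr_eq0.
by move=> x; rewrite !(rmorphM, rmorphXn, fmorphV, rmorph_nat).
Qed.

Lemma primitive_poly c p :
  exists2 F, holo whole_plane F (fun x => x ^+ p * (1 + x) ^+ c) & csym F.
Proof.
elim: c p => [|c IH] p.
  have [F hF sF] := primitive_Xn whole_plane p; exists F => //.
  by apply: holo_eq hF => x _; rewrite mulr1.
have [F hF sF] := IH p; have [G hG sG] := IH p.+1.
exists (fun x => F x + G x); last by move=> x; rewrite sF sG rmorphD.
by apply: holo_eq (holoD hF hG) => x _; rewrite [_ ^+ c.+1]exprS exprS; ring.
Qed.

Lemma csym_clog : csym clog.
Proof.
move=> [a b]; rewrite /clog /= sqrrN; congr (_ +i* _).
by rewrite mulNr atanN.
Qed.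

Lemma primitive_Vn k :
  exists2 F, holo half_plane F (fun x => (1 + x)^-1 ^+ k) & csym F.
Proof.
have sV (x : C) : (1 + conjc x)^-1 = conjc (1 + x)^-1.
  by rewrite fmorphV rmorphD rmorph1.
case: k => [|[|k]].
- exists id => //; exact: holo_eq (@holo_id R _).
- exists (fun x => clog (1 + x)).
    by apply: holo_eq (holo_clog _ (@holo_1D _)) => // x _; rewrite mulr1 expr1.
  by move=> x; rewrite -csym_clog rmorphD rmorph1.
- exists (fun x => (- k.+1%:R^-1) * (1 + x)^-1 ^+ k.+1); last first.
    by move=> x; rewrite !(rmorphM, rmorphXn, rmorphN, fmorphV, rmorph_nat, rmorphD, rmorph1).
  apply: holo_eq (holoZ _ (holoX k.+1 (holoV half_plane_neq0 (@holo_1D _)))) => x hx /=.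
  set q := (1 + x)^-1.
  have e : k.+1%:R^-1 * k.+1%:R = 1 :> C by rewrite mulVf// pnatr_eq0.
  transitivity (k.+1%:R^-1 * k.+1%:R * (q ^+ k * q ^+ 2)); first by ring.
  by rewrite e mul1r -exprD addn2.
Qed.

(** Writing one factor [x] as [(1 + x) - 1] lowers the exponent of [x] until
   only a power of [1 + x] is left; this avoids partial fractions. *)
Lemma primitive_ratfrac p k :
  exists2 F, holo half_plane F (fun x => x ^+ p * (1 + x)^-1 ^+ k) & csym F.
Proof.
elim: p k => [|p IH] k.
  have [F hF sF] := primitive_Vn k; exists F => //.
  by apply: holo_eq hF => x _; rewrite mul1r.
case: k => [|k].
  have [F hF sF] := primitive_Xn half_plane p.+1; exists F => //.
  by apply: holo_eq hF => x _; rewrite mulr1.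
have [F hF sF] := IH k; have [G hG sG] := IH k.+1.
exists (fun x => F x + (- 1) * G x).
  apply: holo_eq (holoD hF (holoZ (-1) hG)) => x /half_plane_neq0 x0.
  rewrite [_ ^+ k.+1]exprS [x ^+ p.+1]exprS.
  set q := (1 + x)^-1.
  have e : x * q = 1 - q by rewrite /q; field.
  transitivity (x ^+ p * q ^+ k * (x * q)); last by ring.
  by rewrite e; ring.
by move=> x; rewrite sF sG rmorphD rmorphM rmorphN rmorph1.
Qed.

(** ** Integration along arcs of the unit circle and along rays *)

Definition eturn (t : R) : C := expi (2 * pi * t).

Lemma cderive_eturn t : cderive eturn t ((0 +i* (2 * pi)) * eturn t).
Proof.
have d : is_derive t 1 (fun u : R => 2 * pi * u) (2 * pi).
  apply: (@is_derive_eq _ _ _ _ _ _ _ _ (is_deriveZ (2 * pi) (@is_derive_id _ _ t 1))).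
  by rewrite /GRing.scale /= mulr1.
split.
- apply: (@is_derive_eq _ _ _ _ _ _ _ _ (@is_derive1_comp _ cos (fun u => 2 * pi * u) t _ _ (is_derive_cos _) d)).
  by rewrite /=; ring.
- apply: (@is_derive_eq _ _ _ _ _ _ _ _ (@is_derive1_comp _ sin (fun u => 2 * pi * u) t _ _ (is_derive_sin _) d)).
  by rewrite /=; ring.
Qed.

Lemma theta_arc D F f t : theta D F f -> D (eturn t) ->
  is_derive t 1 (fun u => Im (F (eturn u))) (2 * pi * Re (f (eturn t))).
Proof.
move=> [F' hF hf] Dt; have [_ h] := hF _ _ _ (cderive_eturn t) Dt.
apply: (@is_derive_eq _ _ _ _ _ _ _ _ h).
by rewrite -hf// !(ImM, ReM)/=; ring.
Qed.

Lemma theta_arc_continuous D F f t : theta D F f -> D (eturn t) ->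
  {for t, continuous (fun u => Re (F (eturn u)))} /\
  {for t, continuous (fun u => Im (F (eturn u)))}.
Proof.
move=> [F' hF hf] Dt; exact: (cderive_continuous (hF _ _ _ (cderive_eturn t) Dt)).
Qed.

(** The derivative of [Im (F (e(t)))] in [t] is [2 pi Re (f (e(t)))], because
   [e(t)] has derivative [2 i pi e(t)]. *)
Lemma integral_arc D F f f1 a b : a < b ->
  (forall t, a <= t <= b -> D (eturn t)) ->
  theta D F f -> theta D f f1 ->
  \int[lebesgue_measure]_(t in `[a, b]) Re (f (eturn t)) =
    (Im (F (eturn b)) - Im (F (eturn a))) / (2 * pi).
Proof.
move=> ab Dab hF hf; have pi0 : 2 * pi != 0 :> R by rewrite mulf_neq0// gt_eqF// pi_gt0.
pose P u := (2 * pi)^-1 * Im (F (eturn u)).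
have dP (t : R) : a <= t <= b -> is_derive t 1 P (Re (f (eturn t))).
  move=> /Dab Dt; apply: (@is_derive_eq _ _ _ _ _ _ _ _ (is_deriveZ (2 * pi)^-1 (theta_arc hF Dt))).
  by rewrite /GRing.scale /= mulKf.
have cP (t : R) : a <= t <= b -> {for t, continuous P}.
  by move=> /dP [h _]; apply/differentiable_continuous/derivable1_diffP.
rewrite /Rintegral (@continuous_FTC2 _ _ P a b) //.
- by rewrite -EFinB /= -mulrBr mulrC.
- apply: continuous_in_subspaceT => t; rewrite inE /= in_itv /= => /Dab Dt.
  by have [] := theta_arc_continuous hf Dt.
- split.
  + move=> t; rewrite in_itv /= => /andP[at_ tb].
    have tab : a <= t <= b by rewrite !ltW.
    by have [] := dP t tab.
  + by apply: cvg_at_right_filter; apply: cP; rewrite lexx ltW.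
  + by apply: cvg_at_left_filter; apply: cP; rewrite lexx ltW.
- move=> t; rewrite in_itv /= => /andP[at_ tb].
  have tab : a <= t <= b by rewrite !ltW.
  by rewrite derive1E; have [_ ->] := dP t tab.
Qed.

Lemma normc_ge_Im (z : C) : `|Im z| <= normc z.
Proof.
rewrite normc_sqrt -sqrtr_sqr ler_sqrt ?addr_ge0 ?sqr_ge0//.
by rewrite lerDr sqr_ge0.
Qed.

Lemma normc_ge_Re (z : C) : `|Re z| <= normc z.
Proof.
rewrite normc_sqrt -sqrtr_sqr ler_sqrt ?addr_ge0 ?sqr_ge0//.
by rewrite lerDl sqr_ge0.
Qed.

(** Along [r |-> w r] the derivative of [F] is [f (w r) / r], so a bound
   [K r^(p+1)] on [f] integrates to [K / (p+1)]. The comparison of derivatives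
   replaces an integral over the ray. *)
Lemma theta_ray D F f (w : C) (K : R) p :
  (forall r : R, 0 <= r <= 1 -> D (w * r%:C)) ->
  theta D F f ->
  (forall r : R, 0 < r < 1 -> normc (f (w * r%:C)) <= K * r ^+ p.+1) ->
  `|Im (F w) - Im (F 0)| <= K / p.+1%:R.
Proof.
move=> Dw [F' hF hf] le_f.
have dF (r : R) : 0 <= r <= 1 -> is_derive r 1 (fun u : R => Im (F (w * u%:C))) (Im (F' (w * r%:C) * w)).
  move=> /Dw Dr.
  have dr : cderive (fun u : R => w * u%:C) r w.
    have h : cderive (fun u : R => u%:C) r 1.
      by split; [exact: is_derive_id|exact: is_derive_cst].
    apply: cderive_eq (cderiveM (cderive_cst w r) h) _.
    by rewrite mul0r add0r mulr1.
  by have [] := hF _ _ _ dr Dr.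
pose b (r : R) : R := K / p.+1%:R * r ^+ p.+1.
have db (r : R) : is_derive r 1 b (K * r ^+ p).
  have -> : b = (K / p.+1%:R) \*: ((id : R -> R) ^+ p.+1).
    by apply/funext => u; rewrite /b/= exprfctE.
  apply: (@is_derive_eq _ _ _ _ _ _ _ _ (is_deriveZ (K / p.+1%:R) (is_deriveX p.+1 (@is_derive_id _ _ r 1)))).
  by rewrite /GRing.scale /= mulr1 -mulr_natl mulrA divfK// pnatr_eq0.
have bnd (r : R) : 0 < r < 1 -> `|Im (F' (w * r%:C) * w)| <= K * r ^+ p.
  move=> r01; have /andP[r0 r1] := r01; apply: le_trans (normc_ge_Im _) _.
  have Dr : D (w * r%:C) by apply: Dw; rewrite !ltW.
  have := le_f _ r01; rewrite -hf// !normcM.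
  have -> : normc (r%:C : C) = r by rewrite /= expr0n addr0 sqrtr_sqr gtr0_norm.
  rewrite exprSr mulrA => h; rewrite -(ler_pM2r r0); apply: le_trans h.
  by rewrite le_eqVlt; apply/orP; left; apply/eqP; ring.
have key (s : R) : `|s| = 1 -> s * (Im (F w) - Im (F 0)) <= K / p.+1%:R.
  move=> s1; pose h (r : R) := b r - s * Im (F (w * r%:C)).
  have dh (r : R) : 0 <= r <= 1 -> is_derive r 1 h (K * r ^+ p - s * Im (F' (w * r%:C) * w)).
    by move=> r01; exact: (is_deriveB (db r) (is_deriveZ s (dF r r01))).
  have hd r : r \in `]0, 1[%R -> derivable h r 1.
    rewrite in_itv /= => /andP[r0 r1].
    have r01 : 0 <= r <= 1 by rewrite !ltW.
    by have [] := dh r r01.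
  have hge r : r \in `]0, 1[%R -> 0 <= h^`() r.
    rewrite in_itv /= => /andP[r0 r1].
    have r01 : 0 <= r <= 1 by rewrite !ltW.
    rewrite derive1E; have [_ ->] := dh r r01; rewrite subr_ge0.
    apply: le_trans (ler_norm _) _; rewrite normrM s1 mul1r; apply: bnd.
    by rewrite r0.
  have hc : {within `[0, 1], continuous h}.
    apply: continuous_in_subspaceT => r; rewrite inE /= in_itv /= => r01.
    by have [h1 _] := dh r r01; apply/differentiable_continuous/derivable1_diffP.
  have in0 : (0 : R) \in `[0, 1]%R by rewrite in_itv /= lexx ler01.
  have in1 : (1 : R) \in `[0, 1]%R by rewrite in_itv /= lexx ler01.
  have := ger0_derive1_le_cc hd hge hc in0 in1 ler01.
  rewrite /h /b expr0n expr1n /= rmorph0 rmorph1 !mulr0 !mulr1 sub0r.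
  by rewrite lerBrDr addrC mulrBr.
rewrite ler_norml; apply/andP; split.
- by have := key (-1); rewrite normrN normr1 mulN1r lerNl; apply.
- by have := key 1; rewrite normr1 mul1r; apply.
Qed.

End Theta.

(** * The logarithmic series *)

Section LogSeries.
Context {R : realType}.
Local Notation C := R[i].

Lemma normc_ge0 (z : C) : 0 <= normc z.
Proof. by rewrite normc_sqrt sqrtr_ge0. Qed.

Lemma normcX (z : C) n : normc (z ^+ n) = normc z ^+ n.
Proof. by elim: n => [|n IH]; rewrite ?expr0 ?normc1// !exprS normcM IH. Qed.

Lemma normc_real (r : R) : normc (r%:C : C) = `|r|.
Proof. by rewrite /= expr0n addr0 sqrtr_sqr. Qed.

Lemma normc_1D_ge (z : C) : 1 - normc z <= normc (1 + z).
Proof.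
rewrite lerBlDr -normc1 -[X in normc X](addrK z) -(normcN z).
exact: le_normcD.
Qed.

Lemma normc_1D_le (z : C) : normc (1 + z) <= 1 + normc z.
Proof. by rewrite -normc1; exact: le_normcD. Qed.

Lemma half_plane_disc (z : C) : normc z < 1 -> half_plane z.
Proof.
move=> z1; rewrite /half_plane ReD /=.
by have := normc_ge_Re z; rewrite ler_norml => /andP[h _]; lra.
Qed.

(** The Euler derivatives of [log (1 + z)] and of its Taylor polynomial differ
   by [z (- z)^n / (1 + z)], by the geometric sum; the ray estimate from [0]
   to [z] then bounds the remainder in terms of [rho] only, as is needed to
   integrate the expansion. *)
Lemma ln_normc_1D (z : C) (rho : R) n : normc z <= rho -> rho < 1 ->
  `|ln (normc (1 + z)) - \sum_(k < n) (-1) ^+ k * (Re (z ^+ k.+1) / k.+1%:R)|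
    <= rho ^+ n.+1 / (1 - rho).
Proof.
move=> zr r1; have z1 := le_lt_trans zr r1; have z0 := normc_ge0 z.
have r0 := le_trans z0 zr.
pose D : C -> Prop := fun x => normc x < 1.
(* The factor [i] turns the real part into the imaginary part that
   [theta_ray] controls. *)
pose F (x : C) := 'i * (clog (1 + x) + \sum_(k < n) ((-1) ^+ k.+1 / k.+1%:R) * x ^+ k.+1).
pose f (x : C) := 'i * (x * ((- x) ^+ n / (1 + x))).
have hF : theta D F f.
  pose g (x : C) := x * (1 + x)^-1 +
    \sum_(k < n) ((-1) ^+ k.+1 / k.+1%:R) * (k.+1%:R * x ^+ k.+1).
  apply: (@theta_eq _ _ _ (fun x => 'i * g x)).
    move=> x /half_plane_disc /half_plane_neq0 x0; rewrite /f /g; congr (_ * _).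
    under eq_bigr => k _ do rewrite mulrA divfK ?pnatr_eq0//.
    rewrite [X in _ + X](_ : _ = - x * \sum_(k < n) (- x) ^+ k); last first.
      rewrite mulr_sumr; apply: eq_bigr => k _.
      by rewrite -exprS [(- x) ^+ _]exprNn.
    have e : (1 + x) * (\sum_(k < n) (- x) ^+ k) = 1 - (- x) ^+ n.
      by rewrite -[RHS]opprB subrX1; ring.
    apply: (mulfI x0); rewrite !mulrDr [X in _ + X]mulrCA e.
    by field.
  apply: thetaZ; apply: thetaD.
    exists (fun x => (1 + x)^-1 * 1); last by move=> x _; rewrite mulr1.
    by apply: holo_clog; [move=> x /half_plane_disc|exact: holo_1D].
  by apply: theta_sum => k; apply: thetaZ; exact: thetaXn.
have := @theta_ray _ D F f z (rho ^+ n.+1 / (1 - rho)) n.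
have Fz x : Im (F x) = ln (normc (1 + x)) - \sum_(k < n) (-1) ^+ k * (Re (x ^+ k.+1) / k.+1%:R).
  rewrite /F ImM/= mul0r add0r mul1r ReD/=; congr (_ + _).
  rewrite -sumrN; elim/big_ind2: _ => // [a b c d|k _]; first by rewrite ReD => -> ->.
  have -> : (-1) ^+ k.+1 / k.+1%:R = ((-1) ^+ k.+1 / k.+1%:R : R)%:C :> C.
    by rewrite !(rmorphM, fmorphV, rmorph_nat, rmorphXn, rmorphN, rmorph1).
  by rewrite ReM /= mul0r subr0 exprS; ring.
have F0 : Im (F 0) = 0.
  rewrite Fz addr0 normc1 ln1 big1 ?subr0// => k _.
  by rewrite exprS mul0r mul0r mulr0.
rewrite F0 subr0 Fz.
move=> h; have Dz r : 0 <= r <= 1 -> D (z * r%:C).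
  move=> /andP[r0' r1']; rewrite /D normcM normc_real ger0_norm//.
  by apply: le_lt_trans z1; rewrite ler_piMr.
apply: (le_trans (h Dz hF _)).
- move=> r /andP[r0' r1'].
  rewrite /f !normcM normcV normcX normcN !normcM normc_real (gtr0_norm r0').
  rewrite /= expr0n expr1n add0r sqrtr1 mul1r.
  set w := normc (1 + _).
  have w0 : 1 - rho <= w.
    apply: le_trans (normc_1D_ge _); rewrite lerD2l lerN2 normcM normc_real gtr0_norm//.
    by apply: le_trans zr; rewrite ler_piMr// ltW.
  have p0 : 0 < 1 - rho by rewrite subr_gt0.
  rewrite mulrA -exprS exprMn mulrAC ler_pM2r ?exprn_gt0//.
  apply: ler_pM; rewrite ?exprn_ge0 ?invr_ge0 ?(le_trans (ltW p0) w0)//.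
    by rewrite lerXn2r ?nnegrE.
  by rewrite lef_pV2// posrE (lt_le_trans p0).
- rewrite ler_pdivrMr ?ltr0Sn// ler_peMr//; last by rewrite ler1n.
  by rewrite divr_ge0 ?exprn_ge0// subr_ge0 ltW.
Qed.

End LogSeries.

(** * Integrating the logarithmic series *)

(** Comparison of [1 / k^2] with a telescoping difference, for explicit bounds
   on the series and its tails. *)
Lemma inv_sqr_telescope (R : realType) (j : nat) :
  (j.+1%:R ^+ 2)^-1 <= 2 / j.+1%:R - 2 / j.+2%:R :> R.
Proof.
set x : R := j.+1%:R; have x1 : 1 <= x by rewrite ler1n.
have -> : j.+2%:R = x + 1 :> R by rewrite -natr1.
have x0 : 0 < x := lt_le_trans ltr01 x1.
rewrite -subr_ge0.
have -> : 2 / x - 2 / (x + 1) - (x ^+ 2)^-1 = (x - 1) / (x ^+ 2 * (x + 1)).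
  by field; rewrite !gt_eqF// addr_gt0.
by rewrite divr_ge0 ?subr_ge0// mulr_ge0 ?addr_ge0 ?exprn_ge0 ?ltW.
Qed.

Section IntegralLog.
Context {R : realType} d (T : measurableType d) (mu : {measure set T -> \bar R}).
Local Notation C := R[i].
Variables (D : set T) (f : T -> C).
Hypotheses (mD : measurable D) (muD : (mu D < +oo)%E).
Hypotheses (mRe : measurable_fun D (fun t => Re (f t)))
           (mIm : measurable_fun D (fun t => Im (f t))).

Lemma bounded_integrable (g : T -> R) M : measurable_fun D g ->
  (forall t, D t -> `|g t| <= M) -> mu.-integrable D (EFin \o g).
Proof.
move=> mg gM; apply: measurable_bounded_integrable => //.
exists M; split; first exact: num_real.
by move=> x Mx t Dt; apply: le_trans (gM _ Dt) (ltW Mx).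
Qed.

Lemma normr_Rintegral_le (g : T -> R) M : measurable_fun D g ->
  (forall t, D t -> `|g t| <= M) ->
  `|\int[mu]_(t in D) g t| <= M * fine (mu D).
Proof.
move=> mg gM; have ig := bounded_integrable mg gM.
apply: le_trans (le_normr_Rintegral mD ig) _.
rewrite -(Rintegral_cst mu mD); apply: le_Rintegral => //.
- exact: (integrable_abse ig).
- by apply: (@bounded_integrable _ `|M|) => //; move=> t _ /=.
Qed.

Lemma measurable_ReIm_exp n :
  measurable_fun D (fun t => Re (f t ^+ n)) /\
  measurable_fun D (fun t => Im (f t ^+ n)).
Proof.
elim: n => [|n [IHr IHi]].
  by split; [exact: (measurable_cst (1 : R))|exact: (measurable_cst (0 : R))].
split.
- under eq_fun do rewrite exprS ReM.
  by apply: measurable_funB; apply: measurable_funM.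
- under eq_fun do rewrite exprS ImM.
  by apply: measurable_funD; apply: measurable_funM.
Qed.

Lemma measurable_ln_normc (a : R) :
  measurable_fun D (fun t => ln (normc (1 + a%:C * f t))).
Proof.
apply: (measurableT_comp (@measurable_ln R)).
under eq_fun => t.
  rewrite normc_sqrt ReD ImD ReM ImM /= !mul0r subr0 addr0 add0r.
  over.
apply: (@measurableT_comp _ _ _ _ _ _ (@Num.sqrt R)).
  exact: (continuous_measurable_fun (@sqrt_continuous R)).
apply: measurable_funD; apply: measurable_funX.
- apply: measurable_funD; first exact: measurable_cst.
  by apply: measurable_funM => //; exact: measurable_cst.
- by apply: measurable_funM => //; exact: measurable_cst.
Qed.

Lemma Rintegral_sum n (c : nat -> R) (g : nat -> T -> R) :
  (forall k, mu.-integrable D (EFin \o g k)) ->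
  mu.-integrable D (EFin \o (fun t => \sum_(k < n) c k * g k t)) /\
  \int[mu]_(t in D) (\sum_(k < n) c k * g k t) =
    \sum_(k < n) c k * \int[mu]_(t in D) g k t.
Proof.
move=> ig; elim: n => [|n [IH1 IH2]].
  rewrite big_ord0; under eq_fun do rewrite big_ord0.
  by split; [exact: integrable0|rewrite Rintegral_cst// mul0r].
have icg : mu.-integrable D (EFin \o (fun t => c n * g n t)).
  exact: (integrableZl mD (c n) (ig n)).
rewrite big_ord_recr /=; under eq_fun do rewrite big_ord_recr /=.
split; first exact: (integrableD mD IH1 icg).
by rewrite RintegralD// IH2 RintegralZl.
Qed.

Hypothesis f1 : forall t, D t -> normc (f t) < 1.

Let I k := \int[mu]_(t in D) Re (f t ^+ k.+1).
Let L (a : R) := \int[mu]_(t in D) ln (normc (1 + a%:C * f t)).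

Lemma integrable_Re_exp k : mu.-integrable D (EFin \o (fun t => Re (f t ^+ k))).
Proof.
apply: (@bounded_integrable _ 1); first by have [] := measurable_ReIm_exp k.
move=> t /f1 ft1; apply: le_trans (normc_ge_Re _) _.
by rewrite normcX exprn_ile1 ?normc_ge0 ?ltW.
Qed.

(** A damping factor [a < 1] makes the logarithmic series converge uniformly,
   although [f] may come arbitrarily close to [-1]. *)
Lemma integral_ln_damped (a : R) n : 0 <= a < 1 ->
  `|L a - \sum_(k < n) (-1) ^+ k * a ^+ k.+1 / k.+1%:R * I k| <=
    a ^+ n.+1 / (1 - a) * fine (mu D).
Proof.
move=> /andP[a0 a1].
have na t : D t -> normc (a%:C * f t) <= a.
  by move=> /f1 ft1; rewrite normcM normc_real ger0_norm// ler_piMr// ltW.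
pose g n t := \sum_(k < n) ((-1) ^+ k * a ^+ k.+1 / k.+1%:R) * Re (f t ^+ k.+1).
have lng m t : D t -> `|ln (normc (1 + a%:C * f t)) - g m t| <= a ^+ m.+1 / (1 - a).
  move=> Dt; have := ln_normc_1D m (na _ Dt) a1.
  congr (is_true (`| _ - _ | <= _)); apply: eq_bigr => k _.
  rewrite exprMn -rmorphXn ReM /= mul0r subr0; ring.
have [ig Eg] := Rintegral_sum n (fun k => (-1) ^+ k * a ^+ k.+1 / k.+1%:R) (fun k => integrable_Re_exp k.+1).
have il : mu.-integrable D (EFin \o (fun t => ln (normc (1 + a%:C * f t)))).
  apply: (@bounded_integrable _ (a ^+ 1 / (1 - a))).
    exact: measurable_ln_normc.
  by move=> t Dt; have := lng 0 t Dt; rewrite /g big_ord0 subr0.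
rewrite /L -Eg -RintegralB//; apply: normr_Rintegral_le => //; last first.
  by move=> t Dt; exact: lng.
apply: measurable_funB; first exact: measurable_ln_normc.
by have /integrableP[/measurable_EFinP] := ig.
Qed.

Variable B : R.
Hypothesis IB : forall k, `|I k| <= B / k.+1%:R.

Let coef k : R := (-1) ^+ k / k.+1%:R * I k.

Lemma B_ge0 : 0 <= B.
Proof. by have := le_trans (normr_ge0 _) (IB 0); rewrite divr1. Qed.

(** The bound does not depend on [a], which allows [a] to tend to one while the
   number of terms stays fixed. *)
Lemma sum_coef_tail (a : R) m n : 0 <= a <= 1 -> (m <= n)%N ->
  `|\sum_(k < n) a ^+ k.+1 * coef k - \sum_(k < m) a ^+ k.+1 * coef k| <=
    B * (2 / m.+1%:R - 2 / n.+1%:R).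
Proof.
move=> /andP[a0 a1] mn; rewrite -(subnK mn) addnC; elim: (n - m)%N => [|p IH].
  by rewrite addn0 !subrr normr0 mulr0.
rewrite addnS big_ord_recr /= addrAC.
apply: le_trans (ler_normD _ _) _.
apply: le_trans (lerD IH (lexx _)) _.
have h : `|a ^+ (m + p).+1 * coef (m + p)| <= B / (m + p).+1%:R ^+ 2.
  have s1 : `|(-1) ^+ (m + p)| = 1 :> R by rewrite normrX normrN1 expr1n.
  rewrite /coef !normrM s1 mul1r.
  rewrite (ger0_norm (exprn_ge0 _ a0)) normrV ?unitfE ?pnatr_eq0// normr_nat.
  apply: (@le_trans _ _ (1 * ((m + p).+1%:R^-1 * (B / (m + p).+1%:R)))).
    apply: ler_pM; rewrite ?exprn_ge0 ?exprn_ile1 ?mulr_ge0 ?invr_ge0 ?ler0n//.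
    by apply: ler_wpM2l; rewrite ?invr_ge0 ?ler0n.
  by rewrite mul1r expr2 invfM le_eqVlt; apply/orP; left; apply/eqP; ring.
apply: le_trans (lerD (lexx _) h) _.
rewrite -mulrDr ler_wpM2l ?B_ge0//.
by rewrite -addrA lerD2l addrC -lerBrDr opprK addrC inv_sqr_telescope.
Qed.

Let damped (i : nat) : R := 1 - (i.+2%:R)^-1.

Lemma damped_bounds i : 0 <= damped i < 1.
Proof.
rewrite /damped subr_ge0 ltrBlDr ltrDl invr_gt0 ltr0Sn andbT.
by rewrite invf_le1 ?ltr0Sn// ler1n.
Qed.

Lemma damped_cvg : damped @ \oo --> (1 : R).
Proof.
rewrite -[X in _ --> X]subr0; apply: cvgB; first exact: cvg_cst.
have := @cvg_harmonic R; rewrite -(cvg_shiftS (@harmonic R)).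
by [].
Qed.

Lemma integral_ln_damped_tail i n :
  `|L (damped i) - \sum_(k < n) damped i ^+ k.+1 * coef k| <= 2 * B / n.+1%:R.
Proof.
have /andP[a0 a1] := damped_bounds i.
set a := damped i in a0 a1 *.
have h p : `|L a - \sum_(k < n) a ^+ k.+1 * coef k| <=
    a ^+ (n + p).+1 / (1 - a) * fine (mu D) + 2 * B / n.+1%:R.
  rewrite -[X in `|X| <= _](subrKA (\sum_(k < n + p) a ^+ k.+1 * coef k)).
  apply: le_trans (ler_normD _ _) _; apply: lerD.
    have := @integral_ln_damped a (n + p) _; rewrite a0 a1 => /(_ erefl).
    congr (is_true (`| _ - _ | <= _)); apply: eq_bigr => k _.
    by rewrite /coef; ring.
  have := @sum_coef_tail a n (n + p); rewrite a0 (ltW a1) => /(_ erefl (leq_addr _ _)).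
  move=> /le_trans -> //; rewrite mulrBr lerBlDr mulrCA mulrA lerDl.
  by rewrite mulr_ge0 ?B_ge0// divr_ge0.
apply: (@cvgr_to_ge _ \oo _ _
  (fun p => a ^+ (n + p).+1 / (1 - a) * fine (mu D) + 2 * B / n.+1%:R)).
- rewrite -[X in _ --> X]add0r; apply: cvgD; last exact: cvg_cst.
  rewrite [X in X @ _ --> _](_ : _ = geometric (a ^+ n.+1 / (1 - a) * fine (mu D)) a).
    by apply: cvg_geometric; rewrite ger0_norm.
  by apply/funext => p; rewrite /geometric/= -addSn exprD; ring.
- by apply: nearW => p; exact: h.
Qed.

Let lnf t := ln (normc (1 + f t)).

Lemma damped_ln_cvg t : D t ->
  (fun i => ln (normc (1 + (damped i)%:C * f t))) @ \oo --> lnf t.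
Proof.
move=> Dt.
have n0 : 0 < normc (1 + f t).
  by apply: lt_le_trans (normc_1D_ge _); rewrite subr_gt0 f1.
apply: (@cvg_comp _ _ _ (fun i => normc (1 + (damped i)%:C * f t)) (@ln R) _ (nbhs (normc (1 + f t)))); last first.
  exact: continuous_ln.
have nE a : normc (1 + a%:C * f t) = Num.sqrt ((1 + a * Re (f t)) ^+ 2 + (a * Im (f t)) ^+ 2).
  by rewrite normc_sqrt ReD ImD ReM ImM /= !mul0r subr0 addr0 add0r.
under eq_fun do rewrite nE.
have -> : normc (1 + f t) = normc (1 + 1%:C * f t) by rewrite mul1r.
rewrite nE; apply: (@cvg_comp _ _ _ _ (@Num.sqrt R)); last exact: sqrt_continuous.
apply: cvgD; rewrite expr2; under eq_fun do rewrite expr2.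
  by apply: cvgM; apply: cvgD; try exact: cvg_cst; apply: cvgMl; exact: damped_cvg.
by apply: cvgM; apply: cvgMl; exact: damped_cvg.
Qed.

Lemma damped_ln_le i t : D t -> ln (normc (1 + (damped i)%:C * f t)) <= ln 2.
Proof.
move=> Dt; have /andP[a0 a1] := damped_bounds i.
have af : normc ((damped i)%:C * f t) < 1.
  rewrite normcM normc_real ger0_norm//.
  by apply: le_lt_trans (f1 Dt); rewrite ler_piMl ?normc_ge0// ltW.
have := normc_1D_ge ((damped i)%:C * f t); have := normc_1D_le ((damped i)%:C * f t).
move=> h1 h2; rewrite ler_ln ?posrE//; first by lra.
by apply: lt_le_trans h2; rewrite subr_gt0.
Qed.

(** [|1 + f| <= |1 + a f| + (1 - a) |f|], and the last term is at most
   [1 - a |f| <= |1 + a f|]. This provides a dominating function independent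
   of [a]. *)
Lemma damped_ln_ge i t : D t ->
  lnf t - ln 2 <= ln (normc (1 + (damped i)%:C * f t)).
Proof.
move=> Dt; have /andP[a0 a1] := damped_bounds i.
have ft := f1 Dt; have ft0 := normc_ge0 (f t).
have n0 : 0 < normc (1 + f t).
  by apply: lt_le_trans (normc_1D_ge _); rewrite subr_gt0.
have nc : normc ((damped i)%:C * f t) = damped i * normc (f t).
  by rewrite normcM normc_real ger0_norm.
have h1 := normc_1D_ge ((damped i)%:C * f t); rewrite nc in h1.
have h2 : normc (1 + f t) <= normc (1 + (damped i)%:C * f t) + (1 - damped i) * normc (f t).
  have -> : 1 + f t = (1 + (damped i)%:C * f t) + (1 - damped i)%:C * f t.
    by move: (damped i) => a; rewrite rmorphB rmorph1; ring.
  apply: le_trans (le_normcD _ _) _; rewrite lerD2l normcM normc_real ger0_norm//.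
  by rewrite subr_ge0 ltW.
have h3 : normc (1 + f t) / 2 <= normc (1 + (damped i)%:C * f t) by nra.
have n1 : 0 < normc (1 + (damped i)%:C * f t).
  by apply: lt_le_trans h3; rewrite divr_gt0.
by rewrite -ln_div ?posrE// ler_ln ?posrE// divr_gt0.
Qed.

Lemma measurable_lnf : measurable_fun D lnf.
Proof.
have -> : lnf = fun t => ln (normc (1 + 1%:C * f t)).
  by apply/funext => t; rewrite mul1r.
exact: measurable_ln_normc.
Qed.

(** The functions [ln 2 - ln |1 + a f|] are nonnegative and their integrals
   stay bounded as [a] tends to one, by the bound on the series; Fatou's lemma
   then gives integrability of the limit, without any study of how fast [1 + f]
   approaches zero. *)
Lemma integrable_lnf : mu.-integrable D (EFin \o lnf).
Proof.
pose g i t := ln 2 - ln (normc (1 + (damped i)%:C * f t)).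
have mg i : measurable_fun D (g i).
  by apply: measurable_funB; [exact: measurable_cst|exact: measurable_ln_normc].
have g0 i t : D t -> 0 <= g i t.
  by move=> Dt; rewrite subr_ge0 damped_ln_le.
have ilr i : mu.-integrable D (EFin \o (fun t => ln (normc (1 + (damped i)%:C * f t)))).
  have /andP[a0 a1] := damped_bounds i.
  apply: (@bounded_integrable _ (damped i ^+ 1 / (1 - damped i))).
    exact: measurable_ln_normc.
  move=> t Dt; have := @ln_normc_1D _ ((damped i)%:C * f t) (damped i) 0.
  rewrite big_ord0 subr0; apply => //.
  by rewrite normcM normc_real ger0_norm// ler_piMr// ltW// f1.
have ic : mu.-integrable D (EFin \o cst (ln 2 : R)).
  by apply: (@bounded_integrable _ `|ln 2|).
have ig i : mu.-integrable D (EFin \o g i) by exact: (integrableB mD ic (ilr i)).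
pose M : R := ln 2 * fine (mu D) + 2 * B.
have gM i : (\int[mu]_(t in D) (g i t)%:E <= M%:E)%E.
  rewrite -(@fineK _ (\int[mu]_(t in D) (g i t)%:E)%E); last exact: integrable_fin_num (ig i).
  rewrite lee_fin -[X in X <= _]/(Rintegral mu D (g i)) RintegralB// Rintegral_cst//.
  rewrite /M lerD2l; have := integral_ln_damped_tail i 0.
  by rewrite big_ord0 subr0 divr1 ler_norml => /andP[h _]; rewrite lerNl.
have := fatou mu mD (fun i => (@measurable_EFinP _ _ _ _ (g i)).2 (mg i)) (fun i t Dt => g0 i t Dt).
set lhs := (X in (X <= _)%E); set rhs := (X in (_ <= X)%E) => le_fatou.
have rhsM : (rhs <= M%:E)%E.
  rewrite /rhs limn_einf_lim; apply: lime_le; first exact: is_cvg_einfs.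
  apply: nearW => i; apply: le_trans (gM i); apply: ereal_inf_lbound.
  by exists i => //=.
have lhsE : lhs = (\int[mu]_(t in D) (ln 2 - lnf t)%:E)%E.
  apply: eq_integral => t; rewrite inE => Dt.
  have h : ((fun i => (g i t)%:E) @ \oo --> (ln 2 - lnf t)%:E)%E.
    apply: cvg_EFin; first by apply: nearW.
    by apply: cvgB; [exact: cvg_cst|exact: damped_ln_cvg].
  by rewrite is_cvg_limn_einfE; [exact/cvg_lim|exact: cvgP h].
have m2 : measurable_fun D (fun t => ln 2 - lnf t).
  by apply: measurable_funB; [exact: measurable_cst|exact: measurable_lnf].
have i2 : mu.-integrable D (EFin \o (fun t => ln 2 - lnf t)).
  apply/integrableP; split; first exact/measurable_EFinP.
  apply: (@le_lt_trans _ _ M%:E); last exact: ltry.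
  apply: le_trans rhsM; apply: le_trans le_fatou; rewrite lhsE.
  rewrite le_eqVlt; apply/orP; left; apply/eqP; apply: eq_integral => t.
  rewrite inE => Dt; rewrite /= ger0_norm// subr_ge0.
  apply: (@cvgr_to_le _ \oo _ _ _ _ _ (damped_ln_cvg Dt)).
  by apply: nearW => i; exact: damped_ln_le.
have := integrableB mD ic i2; apply: eq_integrable => // t _ /=.
by rewrite -EFinB opprB addrC subrK.
Qed.

(** Dominated convergence as the damping factor tends to one, the number [n]
   of terms being fixed. *)
Theorem integral_ln_series n :
  `|\int[mu]_(t in D) lnf t - \sum_(k < n) coef k| <= 2 * B / n.+1%:R.
Proof.
have il := integrable_lnf.
pose G t := 2 * ln 2 + `|lnf t|.
have iG : mu.-integrable D (EFin \o G).
  have ic : mu.-integrable D (EFin \o cst (2 * ln 2 : R)).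
    by apply: (@bounded_integrable _ `|2 * ln 2|).
  exact: (integrableD mD ic (integrable_abse il)).
have := @dominated_cvg _ _ _ mu D mD
  (fun i t => (ln (normc (1 + (damped i)%:C * f t)))%:E) (EFin \o lnf) (EFin \o G).
move=> h.
have l2 : 0 <= ln 2 :> R by rewrite ln_ge0// ler1n.
have {}h : L (damped i) @[i --> \oo] --> \int[mu]_(t in D) lnf t.
  apply: fine_cvg; rewrite fineK; last exact: integrable_fin_num il.
  apply: h => //.
  - by move=> i; apply/measurable_EFinP; exact: measurable_ln_normc.
  - move=> t Dt; apply: cvg_EFin; first by apply: nearW.
    exact: damped_ln_cvg.
  - move=> i t Dt; rewrite /= lee_fin ler_norml /G.
    have h1 := damped_ln_le i Dt; have h2 := damped_ln_ge i Dt.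
    by case: (ger0P (lnf t)) => h3; apply/andP; split; lra.
apply: (@cvgr_to_le _ \oo _ _
  (fun i => `|L (damped i) - \sum_(k < n) damped i ^+ k.+1 * coef k|)).
  apply: cvg_norm; apply: cvgB => //.
  have -> : \sum_(k < n) coef k = \sum_(k < n) 1 ^+ k.+1 * coef k.
    by apply: eq_bigr => k _; rewrite expr1n mul1r.
  elim: n => [|n IH].
    by under eq_fun do rewrite big_ord0; rewrite big_ord0; exact: cvg_cst.
  under eq_fun do rewrite big_ord_recr /=; rewrite big_ord_recr /=.
  apply: cvgD => //; apply: cvgMl.
  elim: (n.+1) => [|m IHm]; first exact: cvg_cst.
  by under eq_fun do rewrite exprS; rewrite exprS; apply: cvgM => //; exact: damped_cvg.
by apply: nearW => i; exact: integral_ln_damped_tail.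
Qed.

End IntegralLog.

(** * Stirling numbers and factorials *)

Section Stirling.

Lemma stirling1_gt j b : (j < b)%N -> stirling1 j b = 0%N.
Proof.
elim: j b => [|j IH] [|b] // jb.
by rewrite /= !IH ?muln0// ltnW.
Qed.

Lemma stirling2_gt j b : (j < b)%N -> stirling2 j b = 0%N.
Proof.
elim: j b => [|j IH] [|b] // jb.
by rewrite /= !IH ?muln0// ltnW.
Qed.

Definition rising (A : comNzRingType) (x : A) j : A := \prod_(i < j) (x + i%:R).

Lemma rising_stirling1 (A : comNzRingType) (x : A) j :
  rising x j = \sum_(b < j.+1) (stirling1 j b)%:R * x ^+ b.
Proof.
elim: j => [|j IH].
  by rewrite /rising big_ord0 big_ord_recl big_ord0 /= addr0 mulr1.
rewrite /rising big_ord_recr /= -/(rising x j) {}IH.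
rewrite mulrDr [RHS]big_ord_recl /= mul0r add0r.
under [RHS]eq_bigr => b _ do rewrite /= -[bump 0 b]/(b.+1) natrD natrM mulrDl.
rewrite big_split /= addrC; congr (_ + _).
- by rewrite mulr_suml; apply: eq_bigr => b _; rewrite exprS add0n; ring.
- rewrite big_ord_recl big_ord_recr /= add0n (stirling1_gt (ltnSn _)) mulr0 mul0r addr0.
  rewrite mulrDl [X in X + _](_ : _ = 0) ?add0r; last first.
    by case: j => [|j] /=; rewrite ?mulr0// !mul0r.
  rewrite mulr_suml; apply: eq_bigr => b _; rewrite -[bump 0 b]/(b.+1) add0n.
  by ring.
Qed.

(** The recurrence of the Stirling numbers of the second kind, transposed: one
   more application of an operator that sends [U_j] to [j U_j + U_(j+1)], as
   the Euler derivative does below. *)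
Lemma sum_stirling2S (A : comNzRingType) (U : nat -> A) m :
  \sum_(j < m.+2) (stirling2 m.+1 j)%:R * U j =
  \sum_(j < m.+1) (stirling2 m j)%:R * (j%:R * U j + U j.+1).
Proof.
rewrite big_ord_recl /= mul0r add0r.
under eq_bigr => j _ do rewrite /= -[bump 0 j]/(j.+1) natrD natrM mulrDl.
under [RHS]eq_bigr => j _ do rewrite mulrDr.
rewrite !big_split /=; congr (_ + _).
rewrite big_ord_recr big_ord_recl /= (stirling2_gt (ltnSn _)) mulr0 !mul0r addr0.
rewrite mulr0 add0r; apply: eq_bigr => j _.
by rewrite -[bump 0 j]/(j.+1); ring.
Qed.

(** The two integrands involve [(1 + x)^-k] and [(1 + x)^k], hence rising and
   falling factorials of [k]; both become rising factorials, at [k] and at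
   [- k]. *)
Lemma falling_rising (A : comNzRingType) k j :
  (k ^_ j)%:R = (-1) ^+ j * rising (- k%:R) j :> A.
Proof.
elim: j => [|j IH]; first by rewrite /rising big_ord0 mulr1.
rewrite ffactnSr natrM {}IH /rising big_ord_recr /= exprS.
have [kj|jk] := ltnP k j; last by rewrite natrB//; ring.
have -> : \prod_(i < j) (- k%:R + i%:R) = 0 :> A.
  by rewrite (bigD1 (Ordinal kj)) //= addNr mul0r.
by rewrite !(mul0r, mulr0).
Qed.

Lemma rising_nat_le (F : realDomainType) (k j M : nat) : (0 < k)%N -> (j <= M)%N ->
  0 <= rising (k%:R : F) j <= (M.+1 * k)%:R ^+ M.
Proof.
move=> k0 jM; rewrite /rising.
have -> : \prod_(i < j) (k%:R + i%:R) = (\prod_(i < j) (k + i))%:R :> F.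
  by rewrite natr_prod; apply: eq_bigr => i _; rewrite natrD.
rewrite ler0n -natrX ler_nat /=.
apply: (@leq_trans ((M.+1 * k) ^ j)); last first.
  by rewrite leq_pexp2l// muln_gt0.
rewrite -[in leqRHS](card_ord j) -prod_nat_const; apply: leq_prod => i _.
rewrite mulSn leq_add2l; apply: (@leq_trans M); last by rewrite leq_pmulr.
by rewrite (leq_trans (ltnW (ltn_ord i))).
Qed.

Lemma ffact_nat_le (F : realDomainType) (k j M : nat) : (0 < k)%N -> (j <= M)%N ->
  0 <= ((k ^_ j)%:R : F) <= (M.+1 * k)%:R ^+ M.
Proof.
move=> k0 jM; rewrite ler0n -natrX ler_nat /=.
apply: (@leq_trans ((M.+1 * k) ^ j)); last first.
  by rewrite leq_pexp2l// muln_gt0.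
rewrite ffact_prod -[in leqRHS](card_ord j) -prod_nat_const; apply: leq_prod => i _.
by apply: leq_trans (leq_subr _ _) _; rewrite leq_pmull.
Qed.

End Stirling.

(** * The primitive cube root of unity *)

Section RootOfUnity.
Context {R : realType}.
Local Notation C := R[i].
Local Notation xi := (xi3 R).

Lemma expiD (a b : R) : expi (a + b) = expi a * expi b.
Proof.
by apply: complexP; rewrite /expi ?ReM ?ImM/= ?cosD ?sinD//; ring.
Qed.

Lemma expi0 : expi 0 = 1 :> C.
Proof. by rewrite /expi cos0 sin0. Qed.

Lemma expi2pi : expi (2 * pi) = 1 :> C.
Proof. by rewrite mulr_natl /expi cos2pi sin2pi. Qed.

Lemma normc_expi (a : R) : normc (expi a) = 1.
Proof. by rewrite /= cos2Dsin2 sqrtr1. Qed.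

Lemma conj_expi (a : R) : conjc (expi a) = expi (- a).
Proof. by rewrite /expi cosN sinN. Qed.

Lemma Re_xi3 : Re xi = - (1 / 2).
Proof.
set a : R := 2 * pi / 3; rewrite /xi3 -/a /=; set c := cos a.
have pi0 := pi_gt0 R.
have s0 : 0 < sin a by rewrite sin_gt0_pi// /a; apply/andP; split; lra.
have := cos2Dsin2 a; rewrite -/c => cs.
(* The angles [a] and [2 a] are opposite modulo [2 pi]. *)
have c2 : c = 2 * c ^+ 2 - 1.
  have -> : 2 * c ^+ 2 - 1 = cos (a + a) by rewrite cosD -/c; lra.
  have -> : a + a = - a + pi *+ 2 by rewrite /a mulr2n; lra.
  by rewrite cosD2pi cosN.
have s2 : 0 < sin a ^+ 2 by rewrite exprn_gt0.
have : (c - 1) * (2 * c + 1) = 0 by lra.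
move=> /eqP; rewrite mulf_eq0 => /orP[|] /eqP h; last by lra.
have c1 : c = 1 by lra.
by rewrite c1 in cs; lra.
Qed.

Lemma Im_xi3 : Im xi = Num.sqrt 3 / 2.
Proof.
have pi0 := pi_gt0 R; have := @Re_xi3.
rewrite /xi3 /=; set a : R := 2 * pi / 3 => c.
have s0 : 0 < sin a by rewrite sin_gt0_pi// /a; apply/andP; split; lra.
have s2 : (2 * sin a) ^+ 2 = 3.
  by have := cos2Dsin2 a; rewrite c exprMn; lra.
by rewrite -s2 sqrtr_sqr gtr0_norm; lra.
Qed.

Lemma normc_xi3 : normc xi = 1.
Proof. exact: normc_expi. Qed.

Lemma sqrt3_sq : Num.sqrt 3 ^+ 2 = 3 :> R.
Proof. by rewrite sqr_sqrtr. Qed.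

Lemma one_xi3 : 1 + xi = - xi ^+ 2.
Proof.
have s3 := sqrt3_sq.
apply: complexP; rewrite ?ReN ?ImN expr2 ?ReM ?ImM ?ReD ?ImD Re_xi3 Im_xi3 /=; lra.
Qed.

Lemma xi3_cube : xi ^+ 3 = 1.
Proof.
have h : xi ^+ 2 = - (1 + xi) by rewrite one_xi3 opprK.
by rewrite exprS h; transitivity (- xi - xi ^+ 2); [ring|rewrite h; ring].
Qed.

Lemma xi3_neq0 : xi != 0.
Proof.
apply/eqP => h; have := normc_xi3; rewrite h normc0 => /eqP.
by rewrite eq_sym oner_eq0.
Qed.

Lemma one_xi3V : (1 + xi)^-1 = - xi.
Proof.
rewrite one_xi3 invrN; congr (- _); rewrite -[LHS]mul1r -{1}xi3_cube exprS.
by rewrite mulfK// expf_neq0// xi3_neq0.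
Qed.

Lemma conj_xi3 : conjc xi = xi ^+ 2.
Proof.
have s3 := sqrt3_sq.
have -> : xi ^+ 2 = - (1 + xi) by rewrite one_xi3 opprK.
have h : conjc xi = Re xi -i* Im xi by case: xi.
rewrite h; apply: complexP; rewrite ?ReN ?ImN ?ReD ?ImD Re_xi3 /=; lra.
Qed.

Lemma normc_one_xi3_ray (r : R) :
  normc (1 + xi * r%:C) = Num.sqrt (1 - r + r ^+ 2).
Proof.
have s3 := sqrt3_sq.
rewrite normc_sqrt; congr Num.sqrt.
rewrite ReD ImD ReM ImM Re_xi3 Im_xi3 /=.
transitivity (1 - r + (1 + Num.sqrt 3 ^+ 2) / 4 * r ^+ 2); first by field.
by rewrite s3; field.
Qed.

End RootOfUnity.

(** * Expansion of the primitives along a ray *)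

Section RayExpansion.
Context {R : realType}.
Local Notation C := R[i].
Local Notation xi := (xi3 R).
Variables (n k : nat).
Hypotheses (n2 : (2 <= n)%N) (k1 : (1 <= k)%N).

Definition fpow (x : C) : C := x ^+ (n * k) * (1 + x)^-1 ^+ k.
Definition gpow (x : C) : C := x ^+ (n.-1 * k) * (1 + x) ^+ k.

(** Up to the sign [(-1) ^ m] in the second case, [x ^ (n k)] times the [m]-th
   iterated Euler derivative of [u ^ k], for [u = 1 / (1 + x)] and for
   [u = 1 + 1 / x] respectively; the powers of [x] are arranged so that only
   nonnegative ones occur. *)
Definition fiter m (x : C) : C := \sum_(j < m.+1)
  (stirling2 m j)%:R * ((-1) ^+ j * rising k%:R j * (x ^+ (n * k + j) * (1 + x)^-1 ^+ (k + j))).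
Definition giter m (x : C) : C := \sum_(j < m.+1)
  (stirling2 m j)%:R * ((k ^_ j)%:R * (x ^+ (n.-1 * k) * (1 + x) ^+ (k - j))).

Lemma fiter0 x : fiter 0 x = fpow x.
Proof.
rewrite /fiter big_ord_recl big_ord0 /= addr0 mul1r expr0 /rising big_ord0.
by rewrite !mul1r !addn0.
Qed.

Lemma giter0 x : giter 0 x = gpow x.
Proof.
rewrite /giter big_ord_recl big_ord0 /= addr0 mul1r ffactn0 mul1r.
by rewrite subn0.
Qed.

Lemma theta_fiter m : theta half_plane (fiter m)
  (fun x => (n * k)%:R * fiter m x + fiter m.+1 x).
Proof.
pose T j (x : C) := x ^+ (n * k + j) * (1 + x)^-1 ^+ (k + j).
have dT j : theta half_plane (T j)
    (fun x => (n * k + j)%:R * T j x - (k + j)%:R * T j.+1 x).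
  apply: theta_eq (thetaM (thetaXn _ _) (theta_1DVXn (k + j) (@half_plane_neq0 R))) => x _.
  by rewrite /T !addnS [x ^+ _.+1]exprS; ring.
apply: theta_eq (theta_sum (index_enum _) (fun j : 'I_m.+1 => thetaZ (stirling2 m j)%:R
  (thetaZ ((-1) ^+ j * rising k%:R j) (dT j)))) => x _ /=.
rewrite /fiter (sum_stirling2S (fun j => (-1) ^+ j * rising k%:R j * T j x)).
rewrite mulr_sumr -big_split /=; apply: eq_bigr => j _.
by rewrite /rising big_ord_recr /= natrD [in RHS]exprS -/(T j x) natrD; ring.
Qed.

Lemma theta_giter m : theta whole_plane (giter m)
  (fun x => (n * k)%:R * giter m x - giter m.+1 x).
Proof.
pose T j (x : C) := x ^+ (n.-1 * k) * (1 + x) ^+ (k - j).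
have dT j : theta whole_plane (T j)
    (fun x => (n.-1 * k + (k - j))%:R * T j x - (k - j)%:R * T j.+1 x).
  apply: theta_eq (thetaM (thetaXn _ _) (theta_1DXn _ (k - j))) => x _.
  by rewrite /T subnS natrD; ring.
apply: theta_eq (theta_sum (index_enum _) (fun j : 'I_m.+1 => thetaZ (stirling2 m j)%:R
  (thetaZ (k ^_ j)%:R (dT j)))) => x _ /=.
rewrite /giter (sum_stirling2S (fun j => (k ^_ j)%:R * T j x)).
rewrite mulr_sumr -sumrB /=; apply: eq_bigr => j _.
rewrite -/(T j x) ffactnSr natrM.
have [kj|jk] := ltnP k j; first by rewrite ffact_small// !(mul0r, mulr0, addr0, subr0).
have -> : (n.-1 * k + (k - j))%:R = (n * k)%:R - j%:R :> C.
  have -> : (n.-1 * k + (k - j) = n * k - j)%N.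
    by rewrite addnBA// -mulSnr prednK ?(leq_trans _ n2).
  by rewrite natrB// (leq_trans jk)// leq_pmull// (leq_trans _ n2).
by ring.
Qed.

Let lam : C := (n * k)%:R.

Let lam_neq0 : lam != 0.
Proof. by rewrite pnatr_eq0 -lt0n muln_gt0 k1 (leq_trans _ n2). Qed.

Definition fsum M (x : C) : C := \sum_(m < M) (-1) ^+ m / lam ^+ m.+1 * fiter m x.
Definition gsum M (x : C) : C := \sum_(m < M) 1 / lam ^+ m.+1 * giter m x.

(** Repeated integration by parts: the Euler derivative of [fiter m] being
   [lam * fiter m + fiter m.+1], the alternating sum telescopes and leaves
   the integrand and one remainder. *)
Lemma theta_fsum M : theta half_plane (fsum M)
  (fun x => fpow x - (-1) ^+ M / lam ^+ M * fiter M x).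
Proof.
apply: theta_eq (theta_sum (index_enum _)
  (fun m : 'I_M => thetaZ ((-1) ^+ m / lam ^+ m.+1) (theta_fiter m))) => x _ /=.
rewrite -fiter0 -[fiter 0 x]mul1r; elim: M => [|M IH].
  by rewrite big_ord0 !expr0 divr1 subrr.
rewrite big_ord_recr /= IH -/lam.
rewrite -addrA; congr (_ + _); rewrite [(-1) ^+ M.+1]exprS [lam ^+ M.+1]exprS.
by move: (lam) lam_neq0 => l l0; field; rewrite l0 expf_neq0.
Qed.

Lemma theta_gsum M : theta whole_plane (gsum M)
  (fun x => gpow x - 1 / lam ^+ M * giter M x).
Proof.
apply: theta_eq (theta_sum (index_enum _)
  (fun m : 'I_M => thetaZ (1 / lam ^+ m.+1) (theta_giter m))) => x _ /=.
rewrite -giter0 -[giter 0 x]mul1r; elim: M => [|M IH].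
  by rewrite big_ord0 !expr0 divr1 subrr.
rewrite big_ord_recr /= IH -/lam.
rewrite -addrA; congr (_ + _); rewrite [lam ^+ M.+1]exprS.
by move: (lam) lam_neq0 => l l0; field; rewrite l0 expf_neq0.
Qed.

Lemma fsum0 M : fsum M 0 = 0.
Proof.
rewrite /fsum big1// => m _; rewrite /fiter big1 ?mulr0// => j _.
rewrite expr0n addn_eq0 muln_eq0 (gtn_eqF k1) (gtn_eqF (leq_trans _ n2))//=.
by rewrite mul0r !mulr0.
Qed.

Lemma gsum0 M : gsum M 0 = 0.
Proof.
rewrite /gsum big1// => m _; rewrite /giter big1 ?mulr0// => j _.
rewrite expr0n muln_eq0 (gtn_eqF k1) orbF.
have -> : (n.-1 == 0)%N = false by case: n n2 => [|[]].
by rewrite mul0r !mulr0.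
Qed.

(** Constant in the bound [iterbound M * k ^ M] for the sum of the coefficients
   of [fiter M] and of [giter M]. *)
Definition iterbound M : nat := (\sum_(j < M.+1) stirling2 M j) * M.+1 ^ M.

Lemma iterbound_sum M (u : nat -> R) (b : R) : 0 <= b ->
  (forall j, (j <= M)%N -> 0 <= u j <= (M.+1 * k)%:R ^+ M * b) ->
  \sum_(j < M.+1) (stirling2 M j)%:R * u j <= (iterbound M)%:R * k%:R ^+ M * b.
Proof.
move=> b0 ub; rewrite /iterbound natrM natr_sum !mulr_suml; apply: ler_sum => j _.
rewrite -!mulrA ler_wpM2l//.
have := ub j; rewrite -ltnS ltn_ord => /(_ erefl) /andP[_ /le_trans]; apply.
by rewrite natrM exprMn natrX mulrA.
Qed.

Lemma ray_half_plane (r : R) : 0 <= r <= 1 -> half_plane (xi * r%:C).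
Proof.
move=> /andP[r0 r1]; rewrite /half_plane ReD ReM Re_xi3 /= mulr0 subr0; lra.
Qed.

Lemma normc_le_xi3_ray (r : R) : 0 < r < 1 -> r <= normc (1 + xi * r%:C) <= 1.
Proof.
move=> /andP[r0 r1]; rewrite normc_one_xi3_ray -{1}(gtr0_norm r0) -sqrtr_sqr.
rewrite -[X in _ <= _ <= X]sqrtr1 !ler_sqrt//; last by nra.
by apply/andP; split; nra.
Qed.

Lemma normc_sum (I : Type) (s : seq I) (F : I -> C) :
  normc (\sum_(i <- s) F i) <= \sum_(i <- s) normc (F i).
Proof.
elim/big_ind2: _ => [|a b c d ab cd|i _]; rewrite ?normc0//.
by apply: le_trans (le_normcD _ _) _; exact: lerD.
Qed.

Lemma normc_nat m : normc (m%:R : C) = m%:R.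
Proof. by rewrite -(rmorph_nat (real_complex R)) normc_real normr_nat. Qed.

Lemma normc_sign m : normc ((-1 : C) ^+ m) = 1.
Proof. by rewrite normcX normcN normc1 expr1n. Qed.

(** [|1 + xi r| >= r] absorbs the negative powers of [1 + x]. *)
Lemma normc_fiter_ray M (r : R) : 0 < r < 1 ->
  normc (fiter M (xi * r%:C)) <= (iterbound M)%:R * k%:R ^+ M * r ^+ (n.-1 * k).
Proof.
move=> r01; have /andP[r0 r1] := r01; have /andP[w0 w1] := normc_le_xi3_ray r01.
set w := normc (1 + _) in w0 w1.
apply: le_trans (normc_sum _ _) _.
have -> : \sum_(j < M.+1) normc ((stirling2 M j)%:R * ((-1) ^+ j * rising k%:R j *
    ((xi * r%:C) ^+ (n * k + j) * (1 + xi * r%:C)^-1 ^+ (k + j)))) =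
  \sum_(j < M.+1) (stirling2 M j)%:R * (rising k%:R j * (r ^+ (n * k + j) * w^-1 ^+ (k + j))).
  apply: eq_bigr => j _; rewrite !normcM normc_sign !normcX !normcM normcV normc_xi3.
  rewrite normc_real (gtr0_norm r0) normc_nat !mul1r -/w.
  have -> : rising k%:R j = (rising k%:R j : R)%:C :> C.
    by rewrite /rising rmorph_prod; apply: eq_bigr => i _; rewrite rmorphD !rmorph_nat.
  by rewrite normc_real ger0_norm//; have /andP[] := @rising_nat_le R _ _ _ k1 (leqnn j).
apply: (@iterbound_sum _ (fun j => rising k%:R j * (r ^+ (n * k + j) * w^-1 ^+ (k + j)))).
  by rewrite exprn_ge0 ?ltW.
move=> j jM; have /andP[c0 c1] := @rising_nat_le R _ _ _ k1 jM.
have wp : 0 < w by apply: lt_le_trans w0.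
have z0 : 0 <= r ^+ (n * k + j) * w^-1 ^+ (k + j).
  by rewrite mulr_ge0 ?exprn_ge0 ?invr_ge0 ?ltW.
rewrite mulr_ge0//=; apply: ler_pM => //.
have -> : (n * k + j = n.-1 * k + (k + j))%N.
  by rewrite addnA -mulSnr prednK ?(leq_trans _ n2).
rewrite exprD -mulrA ler_piMr ?exprn_ge0 ?(ltW r0)//.
rewrite -exprMn exprn_ile1 ?mulr_ge0 ?invr_ge0 ?(ltW r0) ?(ltW wp)//.
by rewrite ler_pdivrMr// mul1r.
Qed.

(** Here [1 + xi r] occurs with nonnegative exponents only, and
   [|1 + xi r| <= 1]. *)
Lemma normc_giter_ray M (r : R) : 0 < r < 1 ->
  normc (giter M (xi * r%:C)) <= (iterbound M)%:R * k%:R ^+ M * r ^+ (n.-1 * k).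
Proof.
move=> r01; have /andP[r0 r1] := r01; have /andP[w0 w1] := normc_le_xi3_ray r01.
set w := normc (1 + _) in w0 w1.
apply: le_trans (normc_sum _ _) _.
have -> : \sum_(j < M.+1) normc ((stirling2 M j)%:R * ((k ^_ j)%:R *
    ((xi * r%:C) ^+ (n.-1 * k) * (1 + xi * r%:C) ^+ (k - j)))) =
  \sum_(j < M.+1) (stirling2 M j)%:R * ((k ^_ j)%:R * (r ^+ (n.-1 * k) * w ^+ (k - j))).
  apply: eq_bigr => j _; rewrite !normcM !normcX !normcM normc_xi3.
  by rewrite normc_real (gtr0_norm r0) !normc_nat !mul1r -/w.
apply: (@iterbound_sum _ (fun j => (k ^_ j)%:R * (r ^+ (n.-1 * k) * w ^+ (k - j)))).
  by rewrite exprn_ge0 ?ltW.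
move=> j jM; have /andP[c0 c1] := @ffact_nat_le R _ _ _ k1 jM.
have wp : 0 < w by apply: lt_le_trans w0.
have z0 : 0 <= r ^+ (n.-1 * k) * w ^+ (k - j).
  by rewrite mulr_ge0 ?exprn_ge0 ?ltW.
rewrite mulr_ge0//=; apply: ler_pM => //.
by rewrite ler_piMr ?exprn_ge0 ?exprn_ile1 ?(ltW r0) ?(ltW wp).
Qed.

Let rho M : R := (iterbound M)%:R / n%:R ^+ M / (n.-1 * k)%:R.

Let nk_gt0 : (0 < n.-1 * k)%N.
Proof. by rewrite muln_gt0 k1 andbT; case: n n2 => [|[]]. Qed.

Lemma ray_bound D M F f (H h : C -> C) :
  (forall r : R, 0 <= r <= 1 -> D (xi * r%:C)) ->
  theta D F f -> csym F -> theta D H (fun x => f x - h x) -> H 0 = 0 ->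
  (forall r : R, 0 < r < 1 -> normc (h (xi * r%:C)) <=
    (iterbound M)%:R / n%:R ^+ M * r ^+ (n.-1 * k)) ->
  `|Im (F xi) - Im (H xi)| <= rho M.
Proof.
move=> Dr hF sF hH H0 hb.
have hd := thetaD hF (thetaZ (-1) hH).
have := @theta_ray _ D _ _ xi ((iterbound M)%:R / n%:R ^+ M) (n.-1 * k).-1 Dr hd.
rewrite H0 !ImD mulr0 addr0 (@csym_Im0 _ F 0 sF erefl) subr0 mulN1r ImN prednK//.
apply => r r01; rewrite mulN1r opprB addrC subrK.
exact: hb.
Qed.

(** The remainder after [M] steps is [fiter M / lam ^ M], and the factor [k ^ M]
   of [fiter M] cancels against [lam ^ M = (n k) ^ M]: the estimate therefore
   keeps a factor [1 / k] for every [M]. *)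
Theorem Im_primitive_fpow M F : theta half_plane F fpow -> csym F ->
  `|Im (F xi) - Im (fsum M xi)| <= rho M.
Proof.
move=> hF sF; apply: (ray_bound ray_half_plane hF sF (theta_fsum M) (fsum0 M)).
move=> r r01; rewrite !normcM normc_sign mul1r normcV normcX normc_nat.
apply: le_trans (ler_wpM2l _ (normc_fiter_ray _ r01)) _.
  by rewrite invr_ge0 exprn_ge0.
rewrite natrM exprMn invfM le_eqVlt; apply/orP; left; apply/eqP.
by field; rewrite !expf_neq0 ?pnatr_eq0 -?lt0n// (leq_trans _ n2).
Qed.

Theorem Im_primitive_gpow M G : theta whole_plane G gpow -> csym G ->
  `|Im (G xi) - Im (gsum M xi)| <= rho M.
Proof.
move=> hG sG; apply: (ray_bound (fun _ _ => Logic.I) hG sG (theta_gsum M) (gsum0 M)).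
move=> r r01; rewrite !normcM normc1 mul1r normcV normcX normc_nat.
apply: le_trans (ler_wpM2l _ (normc_giter_ray _ r01)) _.
  by rewrite invr_ge0 exprn_ge0.
rewrite natrM exprMn invfM le_eqVlt; apply/orP; left; apply/eqP.
by field; rewrite !expf_neq0 ?pnatr_eq0 -?lt0n// (leq_trans _ n2).
Qed.

(** ** Values at the cube root of unity *)

Let zeta : C := xi ^+ n.+1.

Lemma fiter_xi3 m : fiter m xi = (-1) ^+ k * zeta ^+ k *
  \sum_(j < m.+1) (stirling2 m j)%:R * (rising k%:R j * conjc (xi ^+ j)).
Proof.
rewrite /fiter mulr_sumr; apply: eq_bigr => j _.
have cj : conjc (xi ^+ j) = (xi ^+ 2) ^+ j by rewrite -conj_xi3 [LHS]rmorphXn.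
rewrite one_xi3V cj /zeta.
rewrite [(- xi) ^+ _]exprNn -!exprM [(n.+1 * k)%N]mulSn mul2n -addnn !exprD.
have e : (-1) ^+ j * (-1) ^+ j = 1 :> C by rewrite -expr2 sqrr_sign.
transitivity (((-1) ^+ j * (-1) ^+ j) * ((stirling2 m j)%:R * (rising k%:R j *
  (xi ^+ (n * k) * xi ^+ j * ((-1) ^+ k * (xi ^+ k * xi ^+ j)))))); first by ring.
by rewrite e; ring.
Qed.

Lemma giter_xi3 m : giter m xi = (-1) ^+ k * zeta ^+ k *
  \sum_(j < m.+1) (stirling2 m j)%:R * (rising (- k%:R) j * xi ^+ j).
Proof.
rewrite /giter mulr_sumr; apply: eq_bigr => j _.
have x0 : xi != 0 := xi3_neq0.
have y0 : 1 + xi != 0 by rewrite one_xi3 oppr_eq0 expf_neq0.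
have [kj|jk] := ltnP k j.
  have := falling_rising C k j; rewrite ffact_small// => /esym/eqP.
  rewrite mulf_eq0 signr_eq0 /= => /eqP ->.
  by rewrite !(mul0r, mulr0).
rewrite falling_rising.
have -> : (1 + xi) ^+ (k - j) = (1 + xi) ^+ k * (- xi) ^+ j.
  by rewrite -one_xi3V exprVn -[in RHS](subnK jk) exprD mulfK// expf_neq0.
rewrite one_xi3 [(- xi ^+ 2) ^+ k]exprNn [(- xi) ^+ j]exprNn /zeta -!exprM.
have -> : (n.+1 * k = n.-1 * k + 2 * k)%N.
  by rewrite -mulnDl addn2 prednK ?(leq_trans _ n2).
rewrite exprD.
have e : (-1) ^+ j * (-1) ^+ j = 1 :> C by rewrite -expr2 sqrr_sign.
transitivity (((-1) ^+ j * (-1) ^+ j) * ((stirling2 m j)%:R * (rising (- k%:R) j *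
  (xi ^+ (n.-1 * k) * ((-1) ^+ k * xi ^+ (2 * k) * xi ^+ j))))); first by ring.
by rewrite e; ring.
Qed.

End RayExpansion.

(** * The Laurent polynomials [1 + x + y] and [1 + x + x ^ n] *)

Section Evaluation.
Context {R : realType}.
Local Notation C := R[i].

Lemma in_fset3 (T : choiceType) (a b c x : T) :
  (x \in [fset a; b; c]%fset) = (x \in [:: a; b; c]).
Proof. by rewrite !inE -orbA. Qed.

Lemma mem_seq3 (T : eqType) (a b c : T) : let s := [:: a; b; c] in
  [/\ a \in s, b \in s & c \in s].
Proof. by split; rewrite !inE eqxx ?orbT. Qed.

Lemma mem_seq3P (T : eqType) (a b c x : T) :
  reflect [\/ x = a, x = b | x = c] (x \in [:: a; b; c]).
Proof. by rewrite !inE; apply: (iffP or3P) => -[/eqP->|/eqP->|/eqP->];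
  [constructor 1|constructor 2|constructor 3|constructor 1|constructor 2|constructor 3]. Qed.

Lemma big_seq3 (T : eqType) (a b c : T) (P : pred T) (F : T -> C) s :
  perm_eq s [:: a; b; c] ->
  \sum_(e <- s | P e) F e = (if P a then F a else 0) +
    (if P b then F b else 0) + (if P c then F c else 0).
Proof.
move=> ps; rewrite (perm_big _ ps) big_mkcond !big_cons big_nil /= addr0.
by rewrite addrA.
Qed.

Let e00 : 2.-tuple int := [tuple 0; 0].
Let e10 : 2.-tuple int := [tuple 1; 0].
Let e01 : 2.-tuple int := [tuple 0; 1].
Let exps := [:: e00; e10; e01].

Let exps_mem : [/\ e00 \in exps, e10 \in exps & e01 \in exps].
Proof. exact: mem_seq3. Qed.

Lemma one_x_yE e : one_x_y R e = (e \in exps)%:R.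
Proof. by rewrite /one_x_y fsfunE in_fset3; case: (_ \in _). Qed.

Lemma finsupp_one_x_y : perm_eq (finsupp (one_x_y R)) exps.
Proof.
apply: uniq_perm => [|//|e]; first exact: fset_uniq.
by rewrite mem_finsupp one_x_yE; case: (_ \in _); rewrite ?oner_eq0 ?eqxx.
Qed.

Lemma one_x_y_coef e : e \in exps -> one_x_y R e = 1.
Proof. by move=> h; rewrite one_x_yE h. Qed.

Lemma laurent_eval_one_x_y (x y : C) :
  laurent_eval (one_x_y R) [tuple x; y] = 1 + x + y.
Proof.
have [m0 m1 m2] := exps_mem.
rewrite /laurent_eval (big_seq3 _ _ finsupp_one_x_y) !one_x_y_coef//.
by rewrite !big_ord_recl !big_ord0 !(tnth_nth 0) /= !expr0z !expr1z; ring.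
Qed.

(** For [n >= 2] the exponents [0], [1], [n] are distinct, and substitution
   merges no terms. *)
Lemma laurent_eval_subst n (x : C) : (2 <= n)%N ->
  laurent_eval (laurent_subst n (one_x_y R)) [tuple x] = 1 + x + x ^+ n.
Proof.
move=> n2; have [m0 m1 m2] := exps_mem.
pose t0 : 1.-tuple int := [tuple 0]; pose t1 : 1.-tuple int := [tuple 1].
pose tn : 1.-tuple int := [tuple n%:Z].
have s00 : subst_exponent n e00 = t0 by apply: val_inj; rewrite /= !(tnth_nth 0) /= mulr0.
have s10 : subst_exponent n e10 = t1 by apply: val_inj; rewrite /= !(tnth_nth 0) /= mulr0.
have s01 : subst_exponent n e01 = tn.
  by apply: val_inj; rewrite /= !(tnth_nth 0) /= mulr1 add0r.
have d0 : (t0 == tn) = false.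
  by rewrite -val_eqE /= eqseq_cons andbT; case: n n2 @tn {s00 s10 s01} => [|[]].
have d1 : (t1 == tn) = false.
  by rewrite -val_eqE /= eqseq_cons andbT; case: n n2 @tn {s00 s10 s01 d0} => [|[]].
have d2 : (t0 == t1) = false by [].
pose S := [:: t0; t1; tn].
have [M0 M1 Mn] : [/\ t0 \in S, t1 \in S & tn \in S] by exact: mem_seq3.
have uS : uniq S by rewrite /S /= !inE d0 d1 d2.
have imS (m : 1.-tuple int) : (m \in [fset subst_exponent n e | e in finsupp (one_x_y R)]%fset) = (m \in S).
  apply/imfsetP/mem_seq3P => /=.
    move=> [e + ->]; rewrite (perm_mem finsupp_one_x_y) => /mem_seq3P[] ->;
      by [constructor 1|constructor 2|constructor 3].
  by case=> ->; [exists e00|exists e10|exists e01];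
    rewrite // (perm_mem finsupp_one_x_y).
have cf m : m \in S -> laurent_subst n (one_x_y R) m = 1.
  move=> mS; rewrite /laurent_subst fsfunE imS mS (big_seq3 _ _ finsupp_one_x_y).
  rewrite !one_x_y_coef// s00 s10 s01.
  case/mem_seq3P: mS => ->.
  - by rewrite eqxx eq_sym d2 eq_sym d0 !addr0.
  - by rewrite eqxx d2 eq_sym d1 addr0 add0r.
  - by rewrite eqxx d0 d1 !add0r.
have fS : perm_eq (finsupp (laurent_subst n (one_x_y R))) S.
  apply: uniq_perm => [|//|m]; first exact: fset_uniq.
  rewrite mem_finsupp; have [mS|mS] := boolP (m \in S); first by rewrite cf// oner_eq0.
  by rewrite /laurent_subst fsfunE imS (negbTE mS) eqxx.
rewrite /laurent_eval (big_seq3 _ _ fS) !cf//.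
rewrite !big_ord_recl !big_ord0 !(tnth_nth 0) /= expr0z expr1z.
by rewrite -exprnP; ring.
Qed.

End Evaluation.

(** * Arcs of the unit circle and Jensen's formula *)

Section Circle.
Context {R : realType}.
Local Notation C := R[i].
Local Notation xi := (xi3 R).
Local Notation mu := (@lebesgue_measure R).

Lemma eturn0 : eturn 0 = 1 :> C.
Proof. by rewrite /eturn mulr0 expi0. Qed.

Lemma eturn1 : eturn 1 = 1 :> C.
Proof. by rewrite /eturn mulr1 expi2pi. Qed.

Lemma normc_eturn (t : R) : normc (eturn t) = 1.
Proof. exact: normc_expi. Qed.

Lemma eturn_onem (t : R) : eturn (1 - t) = conjc (eturn t).
Proof.
rewrite /eturn conj_expi mulrBr mulr1 -[RHS]mul1r -expi2pi -expiD.
by congr expi; rewrite addrC.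
Qed.

Lemma eturn_third : eturn (1 / 3) = xi.
Proof. by rewrite /eturn /xi3; congr expi; rewrite mulrA mulr1. Qed.

Lemma eturn_two_thirds : eturn (2 / 3) = conjc xi.
Proof. by rewrite -eturn_third -eturn_onem; congr eturn; lra. Qed.

Lemma Re_conjc (z : C) : Re (conjc z) = Re z.
Proof. by case: z. Qed.

Lemma Re_eturn_lt (s t : R) : 0 <= s -> t <= 1 / 2 -> s < t -> Re (eturn t) < Re (eturn s).
Proof.
move=> s0 t1 st; have pi0 := pi_gt0 R; rewrite /= ltr_cos.
- by rewrite ltr_pM2l// mulr_gt0.
- by rewrite in_itv /=; apply/andP; split; nra.
- by rewrite in_itv /=; apply/andP; split; nra.
Qed.

(** The complementary arc also contains its endpoints, where [|1 + x| = 1];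
   they are left out of all comparisons and have measure zero. *)
Definition long_arc (t : R) := (t < 1 / 3) || (2 / 3 < t).

Lemma Re_eturn_long (t : R) : 0 <= t <= 1 -> long_arc t -> - (1 / 2) < Re (eturn t).
Proof.
move=> /andP[t0 t1]; rewrite -(@Re_xi3 R) -eturn_third => /orP[t3|t3].
  by apply: Re_eturn_lt => //; lra.
rewrite -(subKr 1 t) eturn_onem Re_conjc.
by apply: Re_eturn_lt; lra.
Qed.

Lemma Re_eturn_short (t : R) : 1 / 3 < t < 2 / 3 -> Re (eturn t) < - (1 / 2).
Proof.
move=> /andP[t0 t1]; rewrite -(@Re_xi3 R) -eturn_third.
have [h|h] := lerP t (1 / 2); first by apply: Re_eturn_lt => //; lra.
rewrite -(subKr 1 t) eturn_onem Re_conjc.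
by apply: Re_eturn_lt; lra.
Qed.

Lemma normc_1D_eturn (t : R) : normc (1 + eturn t) = Num.sqrt (2 + 2 * Re (eturn t)).
Proof.
have := normc_eturn t; rewrite !normc_sqrt => /(congr1 (fun x => x ^+ 2)).
rewrite sqr_sqrtr ?addr_ge0 ?sqr_ge0// expr1n => h.
by congr Num.sqrt; rewrite ReD ImD [Re 1]/= [Im 1]/=; lra.
Qed.

Lemma normc_1D_eturn_gt1 (t : R) : 0 <= t <= 1 -> long_arc t -> 1 < normc (1 + eturn t).
Proof.
move=> t01 /(Re_eturn_long t01) h; rewrite normc_1D_eturn.
by rewrite -[X in X < _]sqrtr1 ltr_sqrt; lra.
Qed.

Lemma normc_1D_eturn_lt1 (t : R) : 1 / 3 < t < 2 / 3 -> normc (1 + eturn t) < 1.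
Proof.
move=> /Re_eturn_short h; rewrite normc_1D_eturn.
by rewrite -[X in _ < X]sqrtr1 ltr_sqrt; lra.
Qed.

Lemma eturn_half_plane (t : R) : 0 <= t <= 1 -> t <= 1 / 3 \/ 2 / 3 <= t -> half_plane (eturn t).
Proof.
move=> t01 h; suff : - (1 / 2) <= Re (eturn t).
  by rewrite /half_plane ReD [Re 1]/=; lra.
case: h; rewrite le_eqVlt => /orP[/eqP ht|ht].
- by rewrite ht eturn_third Re_xi3.
- by apply/ltW/Re_eturn_long => //; rewrite /long_arc ht.
- by rewrite -ht eturn_two_thirds Re_conjc Re_xi3.
- by apply/ltW/Re_eturn_long => //; rewrite /long_arc ht orbT.
Qed.

Lemma measurable_eturn (D : set (measurableTypeR R)) : measurable D ->
  measurable_fun D (fun t => Re (eturn t)) /\ measurable_fun D (fun t => Im (eturn t)).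
Proof.
have c (t : R) := cderive_continuous (cderive_eturn t).
by move=> mD; split; apply: (@measurable_funS _ _ _ _ setT) => //;
  apply: continuous_measurable_fun => t; have [] := c t.
Qed.

Lemma itvoo_fin (a b : R) : (mu `]a, b[ < +oo)%E.
Proof. by rewrite lebesgue_measure_itv /=; case: ifP => _; rewrite -?EFinB ltry. Qed.

Lemma integrable_itvcc (h : R -> R) (a b : R) :
  mu.-integrable `]a, b[ (EFin \o h) ->
  mu.-integrable `[a, b] (EFin \o h) /\
  \int[mu]_(t in `[a, b]) h t = \int[mu]_(t in `]a, b[) h t.
Proof.
move=> io; have mo := measurable_int _ io; split; last first.
  by rewrite /Rintegral [in LHS]integral_itv_bndoo.
apply/integrableP; split; first exact: emeasurable_fun_itv_cc mo.
have /integrableP[_] := io; apply: le_lt_trans.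
rewrite [leLHS]integral_itv_bndoo//.
exact: (measurableT_comp (@abse_measurable R setT) mo).
Qed.

Lemma Rintegral_glue (h : R -> R) (a b c : R) : a < b -> b < c ->
  mu.-integrable `]a, b[ (EFin \o h) -> mu.-integrable `]b, c[ (EFin \o h) ->
  mu.-integrable `]a, c[ (EFin \o h) /\
  \int[mu]_(t in `]a, c[) h t =
    \int[mu]_(t in `]a, b[) h t + \int[mu]_(t in `]b, c[) h t.
Proof.
move=> ab bc iab ibc; have [ibcc _] := integrable_itvcc ibc.
have ibc' : mu.-integrable `[b, c[ (EFin \o h).
  by apply: integrableS ibcc => //; apply: subset_itvl; rewrite bnd_simp.
have U : (`]a, c[ = `]a, b[ `|` `[b, c[)%classic.
  by rewrite -itv_bndbnd_setU// bnd_simp ltW.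
have dis : [disjoint `]a, b[%classic & `[b, c[%classic].
  apply/disj_setPS => y [/=]; rewrite 2!in_itv/= => /andP[_ yx] /andP[].
  by rewrite leNgt yx.
have m : measurable_fun (`]a, b[ `|` `[b, c[)%classic (EFin \o h).
  by apply/measurable_funU => //; split; [exact: (measurable_int _ iab)|exact: (measurable_int _ ibc')].
have iac : mu.-integrable (`]a, b[ `|` `[b, c[)%classic (EFin \o h).
  apply/integrableP; split => //.
  rewrite ge0_integral_setU//; last exact: (measurableT_comp (@abse_measurable R setT) m).
  by apply: lte_add_pinfty; [have /integrableP[] := iab|have /integrableP[] := ibc'].
rewrite U; split => //; rewrite Rintegral_setU//; congr (_ + _).
by rewrite /Rintegral [in LHS]integral_itv_bndoo//; exact: (measurable_int _ ibc).
Qed.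

(** Primitives of the powers of [z] supply the integrals, and their bound, that
   the integration of the logarithmic series requires. The open interval
   matters: at its endpoints [1 + z] may vanish. *)
Lemma integral_ln_arc D (z z' : C -> C) (F : nat -> C -> C) (a b B : R) :
  a < b -> (forall t, a <= t <= b -> D (eturn t)) ->
  theta D z z' -> (forall k, theta D (F k) (fun x => z x ^+ k.+1)) ->
  (forall t, a < t < b -> normc (z (eturn t)) < 1) ->
  (forall k, `|(Im (F k (eturn b)) - Im (F k (eturn a))) / (2 * pi)| <= B / k.+1%:R) ->
  mu.-integrable `]a, b[ (EFin \o (fun t => ln (normc (1 + z (eturn t))))) /\
  forall n, `|\int[mu]_(t in `]a, b[) ln (normc (1 + z (eturn t))) -
      \sum_(k < n) (-1) ^+ k / k.+1%:R *
        ((Im (F k (eturn b)) - Im (F k (eturn a))) / (2 * pi))| <= 2 * B / n.+1%:R.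
Proof.
move=> ab Dab hz hF z1 FB.
have mD : measurable (`]a, b[ : set (measurableTypeR R)) by exact: measurable_itv.
have cz t : `]a, b[%classic t -> D (eturn t).
  by rewrite /= in_itv /= => /andP[a1 b1]; apply: Dab; rewrite !ltW.
have mz : measurable_fun (`]a, b[ : set (measurableTypeR R)) (fun t => Re (z (eturn t))) /\
          measurable_fun (`]a, b[ : set (measurableTypeR R)) (fun t => Im (z (eturn t))).
  by split; apply: open_continuous_measurable_fun; rewrite ?interval_open//;
    move=> t; rewrite inE => /cz Dt; have [] := theta_arc_continuous hz Dt.
have z1' t : `]a, b[%classic t -> normc (z (eturn t)) < 1 by rewrite /= in_itv; exact: z1.
have thX k : theta D (fun x => z x ^+ k.+1) (fun x => k.+1%:R * z x ^+ k * z' x).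
  case: hz => d hd e; exists (fun x => k.+1%:R * z x ^+ k * d x).
    exact: (holoX k.+1 hd).
  by move=> x Dx; rewrite -e//; ring.
have Ik k : \int[mu]_(t in `]a, b[) Re (z (eturn t) ^+ k.+1) =
    (Im (F k (eturn b)) - Im (F k (eturn a))) / (2 * pi).
  rewrite -(integral_arc ab Dab (hF k) (thX k)) /Rintegral [in RHS]integral_itv_bndoo//.
  apply: ((@measurable_EFinP _ _ _ _ (fun t => Re (z (eturn t) ^+ k.+1))).2).
  exact: (measurable_ReIm_exp mz.1 mz.2 k.+1).1.
have IB k : `|\int[mu]_(t in `]a, b[) Re (z (eturn t) ^+ k.+1)| <= B / k.+1%:R.
  by rewrite Ik.
split; first exact: (integrable_lnf mD (itvoo_fin a b) mz.1 mz.2 z1' IB).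
move=> n; have := integral_ln_series mD (itvoo_fin a b) mz.1 mz.2 z1' IB n.
by under eq_bigr do rewrite Ik.
Qed.

(** ** Jensen's formula for a polynomial of degree one *)

(** All positive powers of [x] have mean zero on the circle, so every term of
   the logarithmic series vanishes. *)
Lemma jensen_1D (c : C) : normc c < 1 ->
  mu.-integrable `[0%R, 1%R] (EFin \o (fun s => ln (normc (1 + c * eturn s)))) /\
  \int[mu]_(s in `[0%R, 1%R]) ln (normc (1 + c * eturn s)) = 0.
Proof.
move=> c1.
have h01 := @integral_ln_arc whole_plane (fun x => c * x) (fun x => c * (1%:R * x ^+ 1))
  (fun k x => (c ^+ k.+1 / k.+1%:R) * x ^+ k.+1) 0 1 0 ltr01 (fun _ _ => Logic.I).
have [] := h01.
- by apply: theta_ext (thetaZ c (thetaXn _ 1)) => x; rewrite expr1.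
- move=> k; apply: theta_eq (thetaZ (c ^+ k.+1 / k.+1%:R) (thetaXn _ k.+1)) => x _.
  by rewrite mulrA divfK ?pnatr_eq0// exprMn.
- by move=> t _; rewrite normcM normc_eturn mulr1.
- by move=> k; rewrite eturn0 eturn1 subrr mul0r normr0 mul0r.
move=> io hn; have [ic ec] := integrable_itvcc io; split => //.
rewrite ec; have := hn 0; rewrite big_ord0 subr0 mulr0 mul0r normr_le0.
by move=> /eqP.
Qed.

(** The larger of [c] and [x] is factored out; if it is [x], then
   [|c + x| = |1 + conj c x|] since [|x| = 1]. *)
Lemma jensen_eturn (c : C) : normc c != 1 ->
  \int[mu]_(s in `[0%R, 1%R]) ln (normc (c + eturn s)) =
    if normc c < 1 then 0 else ln (normc c).
Proof.
rewrite neq_lt => /orP[c1|c1].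
  have cc : normc (conjc c) = normc c by case: (c) => a b; rewrite /= sqrrN.
  have cc1 : normc (conjc c) < 1 by rewrite cc.
  have [_ j0] := jensen_1D cc1; rewrite c1 -[RHS]j0.
  apply: eq_Rintegral => s _; congr ln.
  transitivity (normc (conjc (c + eturn s) * eturn s)).
    rewrite normcM normc_eturn mulr1; case: (c + eturn s) => a b.
    by rewrite /= sqrrN.
  have e1 : conjc (eturn s) * eturn s = 1.
    by rewrite /eturn conj_expi -expiD addNr expi0.
  by congr normc; rewrite rmorphD mulrDl addrC e1.
have c0 : normc c != 0 by rewrite gt_eqF// (lt_trans ltr01).
have cn0 : c != 0 by apply: contraNneq c0 => ->; rewrite normc0.
have ci : normc c^-1 < 1 by rewrite normcV invf_lt1// (lt_trans ltr01).
have [ij ej] := jensen_1D ci; rewrite ltNge (ltW c1) /=.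
transitivity (\int[mu]_(s in `[0%R, 1%R]) (ln (normc c) + ln (normc (1 + c^-1 * eturn s)))).
  apply: eq_Rintegral => s _; rewrite -lnM ?posrE; last 2 first.
  - by rewrite (lt_trans ltr01).
  - apply: lt_le_trans (normc_1D_ge _); rewrite subr_gt0.
    by rewrite normcM normc_eturn mulr1.
  by rewrite -normcM mulrDr mulr1 mulVKf.
have m1 : (mu `[0%R, 1%R] < +oo)%E by rewrite lebesgue_measure_itv /= lte01 -EFinB ltry.
rewrite RintegralD//; last first.
  by apply: (@bounded_integrable _ _ _ _ _ _ _ (cst (ln (normc c))) `|ln (normc c)|).
rewrite ej addr0 Rintegral_cst//.
suff -> : fine (mu `[0%R, 1%R]) = 1 :> R by rewrite mulr1.
by rewrite lebesgue_measure_itv /= lte01 -EFinB /= subr0.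
Qed.

End Circle.

(** * The difference of the two Mahler measures *)

Section MahlerDifference.
Context {R : realType}.
Local Notation C := R[i].
Local Notation xi := (xi3 R).
Local Notation mu := (@lebesgue_measure R).

Lemma mahler1 (P : laurent R 1) :
  mahler P = \int[mu]_(t in `[0%R, 1%R]) ln (normc (laurent_eval P [tuple eturn t])).
Proof.
apply: eq_Rintegral => t _.
by rewrite [LHS]/=; congr (ln (normc (laurent_eval _ _))); apply: val_inj.
Qed.

Lemma mahler2 (P : laurent R 2) :
  mahler P = \int[mu]_(t in `[0%R, 1%R]) \int[mu]_(s in `[0%R, 1%R])
    ln (normc (laurent_eval P [tuple eturn t; eturn s])).
Proof.
apply: eq_Rintegral => t _; apply: eq_Rintegral => s _.
by rewrite [LHS]/=; congr (ln (normc (laurent_eval _ _))); apply: val_inj.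
Qed.

Lemma mahler_subst n : (2 <= n)%N -> mahler (laurent_subst n (one_x_y R)) =
  \int[mu]_(t in `[0%R, 1%R]) ln (normc (1 + eturn t + eturn t ^+ n)).
Proof.
by move=> n2; rewrite mahler1; apply: eq_Rintegral => t _; rewrite laurent_eval_subst.
Qed.

Lemma mahler_one_x_y : mahler (one_x_y R) =
  \int[mu]_(t in `[0%R, 1%R]) \int[mu]_(s in `[0%R, 1%R]) ln (normc (1 + eturn t + eturn s)).
Proof.
rewrite mahler2; apply: eq_Rintegral => t _; apply: eq_Rintegral => s _.
by rewrite laurent_eval_one_x_y.
Qed.

Lemma Rintegral_three (h : R -> R) :
  mu.-integrable `]0%R, 1 / 3[ (EFin \o h) ->
  mu.-integrable `]1 / 3, 2 / 3[ (EFin \o h) ->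
  mu.-integrable `]2 / 3, 1[ (EFin \o h) ->
  \int[mu]_(t in `[0%R, 1%R]) h t = \int[mu]_(t in `]0%R, 1 / 3[) h t +
    \int[mu]_(t in `]1 / 3, 2 / 3[) h t + \int[mu]_(t in `]2 / 3, 1[) h t.
Proof.
move=> i1 i2 i3.
have t3 : (0 : R) < 1 / 3 by lra.
have t32 : (1 / 3 : R) < 2 / 3 by lra.
have t23 : (2 / 3 : R) < 1 by lra.
have [i12 e12] := Rintegral_glue t3 t32 i1 i2.
have [i123 e123] := Rintegral_glue (lt_trans t3 t32) t23 i12 i3.
have [_ ->] := integrable_itvcc i123.
by rewrite e123 e12.
Qed.

Lemma Rintegral_split_diff (a b : R) (p q h j : R -> R) :
  mu.-integrable `]a, b[ (EFin \o p) -> mu.-integrable `]a, b[ (EFin \o q) ->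
  (forall t, a < t < b -> h t = p t + q t) -> (forall t, a < t < b -> j t = p t) ->
  [/\ mu.-integrable `]a, b[ (EFin \o h), mu.-integrable `]a, b[ (EFin \o j) &
   \int[mu]_(t in `]a, b[) h t - \int[mu]_(t in `]a, b[) j t =
   \int[mu]_(t in `]a, b[) q t].
Proof.
move=> ip iq eh ej.
have mD : measurable (`]a, b[ : set (measurableTypeR R)) by exact: measurable_itv.
have ejp : {in `]a, b[%classic, j =1 p}.
  by move=> t; rewrite inE /= in_itv /=; exact: ej.
have ehpq : {in `]a, b[%classic, h =1 (fun t => p t + q t)}.
  by move=> t; rewrite inE /= in_itv /=; exact: eh.
split.
- have := integrableD mD ip iq; apply: eq_integrable => // t tab.
  by rewrite /= ehpq.
- by move: ip; apply: eq_integrable => // t tab; rewrite /= ejp.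
- have -> : \int[mu]_(t in `]a, b[) j t = \int[mu]_(t in `]a, b[) p t.
    exact: eq_Rintegral.
  have -> : \int[mu]_(t in `]a, b[) h t = \int[mu]_(t in `]a, b[) (p t + q t).
    exact: eq_Rintegral.
  rewrite RintegralD//.
  by rewrite addrAC subrr add0r.
Qed.

Lemma integrable_ln_1D_eturn (a b : R) : 0 <= a -> b <= 1 ->
  (forall t, a < t < b -> long_arc t) ->
  mu.-integrable `]a, b[ (EFin \o (fun t => ln (normc (1 + eturn t)))).
Proof.
move=> a0 b1 hab.
have mD : measurable (`]a, b[ : set (measurableTypeR R)) by exact: measurable_itv.
have [mr mi] := measurable_eturn mD.
apply: (bounded_integrable mD (itvoo_fin a b) (M := ln 2)).
  have -> : (fun t => ln (normc (1 + eturn t))) = (fun t => ln (normc (1 + 1%:C * eturn t : C))).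
    by apply/funext => t; rewrite mul1r.
  exact: measurable_ln_normc.
move=> t /=; rewrite in_itv /= => tab; have /andP[t1 t2] := tab.
have t01 : 0 <= t <= 1 by apply/andP; split; lra.
have h1 := normc_1D_eturn_gt1 t01 (hab _ tab).
have h2 := normc_1D_le (eturn t); rewrite normc_eturn in h2.
have p0 : 0 < normc (1 + eturn t) by apply: lt_trans h1.
rewrite ger0_norm; last by rewrite ln_ge0// ltW.
by rewrite ler_ln ?posrE.
Qed.

Variables (n : nat) (F G : nat -> C -> C) (B : R).
Hypotheses (n2 : (2 <= n)%N)
  (hF : forall k, theta half_plane (F k) (fpow n k.+1)) (sF : forall k, csym (F k))
  (hG : forall k, theta whole_plane (G k) (gpow n k.+1)) (sG : forall k, csym (G k))
  (FB : forall k, `|Im (F k xi)| <= B / k.+1%:R)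
  (GB : forall k, `|Im (G k xi)| <= B / k.+1%:R).

Let z1 (x : C) : C := x ^+ n * (1 + x)^-1.
Let z2 (x : C) : C := x ^+ n.-1 * (1 + x).

Lemma fpowE k x : fpow n k x = z1 x ^+ k.
Proof. by rewrite /fpow /z1 exprMn -exprM. Qed.

Lemma gpowE k x : gpow n k x = z2 x ^+ k.
Proof. by rewrite /gpow /z2 exprMn -exprM. Qed.

Lemma half_2pi_le (x b : R) : `|x| <= b -> `|x / (2 * pi)| <= b.
Proof.
move=> xb; have pi2 := pi_ge2 R; have b0 := le_trans (normr_ge0 x) xb.
rewrite normrM normfV ler_pdivrMr; last first.
  by rewrite normr_gt0 mulf_neq0// gt_eqF// pi_gt0.
apply: le_trans xb _; rewrite ler_peMr// ger0_norm ?mulr_ge0 ?pi_ge0//; lra.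
Qed.

Lemma Im_conjc (z : C) : Im (conjc z) = - Im z.
Proof. by case: z. Qed.

Let F1 k : Im (F k 1) = 0. Proof. exact: (@csym_Im0 _ _ 1 (sF k) erefl). Qed.

Lemma theta_z1 : theta half_plane z1
  (fun x => n%:R * x ^+ n * (1 + x)^-1 + x ^+ n * (- 1%:R * (x * (1 + x)^-1 ^+ 2))).
Proof.
apply: theta_ext (thetaM (thetaXn _ n) (theta_1DVXn 1 (@half_plane_neq0 R))) => x.
by [].
Qed.

Lemma theta_z2 : theta whole_plane z2
  (fun x => n.-1%:R * x ^+ n.-1 * (1 + x) + x ^+ n.-1 * (1%:R * (1 + x) ^+ 1 - 1%:R * (1 + x) ^+ 0)).
Proof. by apply: theta_ext (thetaM (thetaXn _ n.-1) (theta_1DXn _ 1)) => x. Qed.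

Lemma hF1 k : theta half_plane (F k) (fun x => z1 x ^+ k.+1).
Proof. by apply: theta_eq (hF k) => x _; rewrite fpowE. Qed.

Lemma hG1 k : theta whole_plane (G k) (fun x => z2 x ^+ k.+1).
Proof. by apply: theta_eq (hG k) => x _; rewrite gpowE. Qed.

Lemma normc_z1 (t : R) : normc (z1 (eturn t)) = (normc (1 + eturn t))^-1.
Proof. by rewrite normcM normcX normc_eturn expr1n mul1r normcV. Qed.

Lemma normc_z2 (t : R) : normc (z2 (eturn t)) = normc (1 + eturn t).
Proof. by rewrite normcM normcX normc_eturn expr1n mul1r. Qed.

Let h (t : R) := ln (normc (1 + eturn t + eturn t ^+ n)).
Let j (t : R) := \int[mu]_(s in `[0%R, 1%R]) ln (normc (1 + eturn t + eturn s)).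

Lemma h_long (t : R) : 0 <= t <= 1 -> long_arc t ->
  h t = ln (normc (1 + eturn t)) + ln (normc (1 + z1 (eturn t))) /\
  j t = ln (normc (1 + eturn t)).
Proof.
move=> t01 tl; have g1 := normc_1D_eturn_gt1 t01 tl.
have g0 : 0 < normc (1 + eturn t) by apply: lt_trans g1.
have n0 : 1 + eturn t != 0.
  by apply/eqP => e; rewrite e normc0 ltxx in g0.
split; last by rewrite /j jensen_eturn ?gt_eqF// ltNge (ltW g1).
rewrite -lnM ?posrE//; last first.
  apply: lt_le_trans (normc_1D_ge _); rewrite subr_gt0 normc_z1.
  by rewrite invf_lt1.
by rewrite -normcM /z1 mulrDr mulr1 mulrCA divff// mulr1.
Qed.

(** Multiplying the conjugate of [1 + x + x^n] by [x^n] gives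
   [x^n + x^(n-1) + 1 = 1 + z2 x], of the same modulus. *)
Lemma h_short (t : R) : 1 / 3 < t < 2 / 3 ->
  h t = 0 + ln (normc (1 + z2 (eturn t))) /\ j t = 0.
Proof.
move=> ts; have g1 := normc_1D_eturn_lt1 ts.
split; last by rewrite /j jensen_eturn ?lt_eqF// g1.
rewrite add0r /h; congr ln.
have cc (z : C) : normc (conjc z) = normc z by case: z => a b; rewrite /= sqrrN.
set x := eturn t.
have cx : conjc x * x = 1.
  by rewrite /x /eturn conj_expi -expiD addNr expi0.
have -> : normc (1 + x + x ^+ n) = normc (conjc (1 + x + x ^+ n) * x ^+ n).
  by rewrite normcM cc normcX normc_eturn expr1n mulr1.
congr normc; rewrite !rmorphD rmorph1 rmorphXn !mulrDl mul1r -exprMn cx expr1n.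
have -> : conjc x * x ^+ n = x ^+ n.-1.
  by rewrite -{1}(prednK (ltnW n2)) exprS mulrA cx mul1r.
by rewrite /z2 mulrDr mulr1 -exprSr prednK ?(ltnW n2)//; ring.
Qed.

(** Over the long arc [1 + x] dominates [x ^ n], over the short one it is
   dominated, and what is left after removing the dominating term, whose
   integral is the Mahler measure of [1 + x + y] by Jensen's formula, is a
   logarithmic series. The long arc is cut at [x = 1], where the parameter
   interval begins and ends. *)
Theorem Delta_series N :
  `|Delta (one_x_y R) n - \sum_(k < N) (-1) ^+ k / k.+1%:R *
      ((Im (F k xi) - Im (G k xi)) / pi)| <= 6 * B / N.+1%:R.
Proof.
have t3 : (0 : R) < 1 / 3 by lra.
have t32 : (1 / 3 : R) < 2 / 3 by lra.
have t23 : (2 / 3 : R) < 1 by lra.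
have long1 (t : R) : 0 < t < 1 / 3 -> (0 <= t <= 1) /\ long_arc t.
  by move=> /andP[a b]; split; [apply/andP; split; lra|rewrite /long_arc b].
have long3 (t : R) : 2 / 3 < t < 1 -> (0 <= t <= 1) /\ long_arc t.
  by move=> /andP[a b]; split; [apply/andP; split; lra|rewrite /long_arc a orbT].
have D1 (t : R) : 0 <= t <= 1 / 3 -> half_plane (eturn t).
  move=> /andP[a b]; apply: eturn_half_plane; last by left.
  by apply/andP; split; lra.
have D3 (t : R) : 2 / 3 <= t <= 1 -> half_plane (eturn t).
  move=> /andP[a b]; apply: eturn_half_plane; last by right.
  by apply/andP; split; lra.
have z1lt (t : R) : 0 <= t <= 1 -> long_arc t -> normc (z1 (eturn t)) < 1.
  move=> t01 tl; have g1 := normc_1D_eturn_gt1 t01 tl.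
  by rewrite normc_z1 invf_lt1// (lt_trans ltr01 g1).
have c1 k : (Im (F k (eturn (1 / 3))) - Im (F k (eturn 0))) / (2 * pi) = Im (F k xi) / (2 * pi).
  by rewrite eturn0 eturn_third F1 subr0.
have c3 k : (Im (F k (eturn 1)) - Im (F k (eturn (2 / 3)))) / (2 * pi) = Im (F k xi) / (2 * pi).
  by rewrite eturn1 eturn_two_thirds F1 sF Im_conjc sub0r opprK.
have c2 k : (Im (G k (eturn (2 / 3))) - Im (G k (eturn (1 / 3)))) / (2 * pi) = - (Im (G k xi) / pi).
  rewrite eturn_third eturn_two_thirds sG Im_conjc.
  by move: (@pi R) (lt0r_neq0 (pi_gt0 R)) => p p0; field.
have [||i1 e1] := integral_ln_arc (B := B) t3 D1 theta_z1 hF1.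
- by move=> t /long1[]; exact: z1lt.
- by move=> k; rewrite c1; apply: half_2pi_le.
have [||i3 e3] := integral_ln_arc (B := B) t23 D3 theta_z1 hF1.
- by move=> t /long3[]; exact: z1lt.
- by move=> k; rewrite c3; apply: half_2pi_le.
have [||i2 e2] := integral_ln_arc (B := B) t32 (fun _ _ => Logic.I) theta_z2 hG1.
- by move=> t /normc_1D_eturn_lt1; rewrite normc_z2.
- move=> k; rewrite c2 normrN.
  rewrite normrM normfV ler_pdivrMr ?normr_gt0 ?gt_eqF ?pi_gt0//.
  apply: le_trans (GB k) _; rewrite ler_peMr ?(le_trans (normr_ge0 _) (GB k))//.
  by rewrite ger0_norm ?pi_ge0//; have := pi_ge2 R; lra.
have l1 : forall t : R, 0 < t < 1 / 3 -> long_arc t by move=> t /long1[].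
have l3 : forall t : R, 2 / 3 < t < 1 -> long_arc t by move=> t /long3[].
have p1 := integrable_ln_1D_eturn (lexx 0) (ltW (lt_trans t32 t23)) l1.
have p3 := integrable_ln_1D_eturn (ltW (lt_trans t3 t32)) (lexx 1) l3.
have p2 : mu.-integrable `]1 / 3, 2 / 3[ (EFin \o cst (0 : R)) by exact: integrable0.
have [h1 j1 d1] := Rintegral_split_diff (h := h) (j := j) p1 i1
  (fun t ht => (h_long (long1 t ht).1 (long1 t ht).2).1)
  (fun t ht => (h_long (long1 t ht).1 (long1 t ht).2).2).
have [h3 j3 d3] := Rintegral_split_diff (h := h) (j := j) p3 i3
  (fun t ht => (h_long (long3 t ht).1 (long3 t ht).2).1)
  (fun t ht => (h_long (long3 t ht).1 (long3 t ht).2).2).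
have [h2 j2 d2] := Rintegral_split_diff (h := h) (j := j) p2 i2
  (fun t ht => (h_short ht).1) (fun t ht => (h_short ht).2).
rewrite /Delta mahler_subst// mahler_one_x_y.
rewrite (Rintegral_three h1 h2 h3) (Rintegral_three j1 j2 j3).
have {}e1 := e1 N; have {}e2 := e2 N; have {}e3 := e3 N.
rewrite -d1 in e1; rewrite -d2 in e2; rewrite -d3 in e3.
have -> : \sum_(k < N) (-1) ^+ k / k.+1%:R * ((Im (F k xi) - Im (G k xi)) / pi) =
   \sum_(k < N) (-1) ^+ k / k.+1%:R *
     ((Im (F k (eturn (1 / 3))) - Im (F k (eturn 0))) / (2 * pi)) +
   \sum_(k < N) (-1) ^+ k / k.+1%:R *
     ((Im (G k (eturn (2 / 3))) - Im (G k (eturn (1 / 3)))) / (2 * pi)) +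
   \sum_(k < N) (-1) ^+ k / k.+1%:R *
     ((Im (F k (eturn 1)) - Im (F k (eturn (2 / 3)))) / (2 * pi)).
  rewrite -!big_split; apply: eq_bigr => k _ /=; rewrite c1 c2 c3 -!mulrDr.
  by congr (_ * _); move: (@pi R) (lt0r_neq0 (pi_gt0 R)) => p p0; field.
move: e1 e2 e3.
set S1 := \sum_(k < N) _; set S2 := \sum_(k < N) _; set S3 := \sum_(k < N) _.
have -> : 6 * B / N.+1%:R = 2 * B / N.+1%:R + 2 * B / N.+1%:R + 2 * B / N.+1%:R.
  by rewrite -!mulrDl; congr (_ * _); ring.
set b := 2 * B / _ => e1 e2 e3.
rewrite -/h -/j.
set H1 := \int[mu]_(t in `]0%R, 1 / 3[) h t in e1 *.
set H2 := \int[mu]_(t in `]1 / 3, 2 / 3[) h t in e2 *.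
set H3 := \int[mu]_(t in `]2 / 3, 1[) h t in e3 *.
set J1 := \int[mu]_(t in `]0%R, 1 / 3[) j t in e1 *.
set J2 := \int[mu]_(t in `]1 / 3, 2 / 3[) j t in e2 *.
set J3 := \int[mu]_(t in `]2 / 3, 1[) j t in e3 *.
have -> : H1 + H2 + H3 - (J1 + J2 + J3) - (S1 + S2 + S3) =
  (H1 - J1 - S1) + (H2 - J2 - S2) + (H3 - J3 - S3) by ring.
apply: le_trans (ler_normD _ _) _; apply: lerD => //.
by apply: le_trans (ler_normD _ _) _; apply: lerD.
Qed.

End MahlerDifference.

(** * Partial sums of the coefficients *)

Section Coefficients.
Context {R : realType}.
Local Notation C := R[i].
Local Notation xi := (xi3 R).

Lemma reimD a (x y : C) : reim a (x + y) = reim a x + reim a y.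
Proof. by rewrite /reim; case: ifP => _; rewrite ?ReD ?ImD. Qed.

Lemma reimZ a (c : R) (x : C) : reim a (c%:C * x) = c * reim a x.
Proof. by rewrite /reim; case: ifP => _; rewrite ?ReM ?ImM /= mul0r ?subr0 ?addr0. Qed.

Lemma reim0 a : reim a (0 : C) = 0.
Proof. by rewrite /reim; case: ifP. Qed.

Lemma reim_sum a (I : Type) (s : seq I) (P : pred I) (f : I -> C) :
  reim a (\sum_(i <- s | P i) f i) = \sum_(i <- s | P i) reim a (f i).
Proof. exact: (big_morph (reim a) (reimD a) (reim0 a)). Qed.

(** The two contour contributions combine into a product of a real or
   imaginary part of [z] and one of [w], according to the parity of [a]. *)
Lemma Im_reim a b m (z w : C) : (a + b = m.+2)%N ->
  Im (z * ((-1) ^+ m * conjc w - (-1) ^+ b * w)) =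
  - 2 * (-1) ^+ b * (reim a z * reim a.+1 w).
Proof.
move=> ab; have -> : (-1) ^+ m = (-1) ^+ b * (-1) ^+ a :> C.
  by rewrite -exprD addnC ab !exprS mulrA mulN1r opprK mul1r.
have -> : z * ((-1) ^+ b * (-1) ^+ a * conjc w - (-1) ^+ b * w) =
    ((-1) ^+ b : R)%:C * (z * ((-1) ^+ a * conjc w - w)).
  have -> : ((-1) ^+ b : R)%:C = (-1) ^+ b :> C by rewrite rmorphXn rmorphN rmorph1.
  by ring.
rewrite [Im _](@reimZ 1) /reim /= -[(-1) ^+ a]signr_odd.
case: (odd a); rewrite ?expr0 ?expr1; by case: z w => [z1 z2] [w1 w2] /=; ring.
Qed.

(** Zero terms with [b > j] are added in order to exchange the sums; then
   [b = m + 2 - a], where [b = 0] contributes nothing. *)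
Lemma sum_antidiagonal (V : zmodType) m (X : nat -> nat -> V) :
  (forall b j, (j < b)%N -> X b j = 0) -> (forall j, X 0%N j = 0) ->
  \sum_(j < m.+1) \sum_(b < j.+1) X b j =
  \sum_(2 <= a < m.+2) \sum_(m.+2 - a <= j < m.+1) X (m.+2 - a)%N j.
Proof.
move=> X1 X0.
transitivity (\sum_(0 <= j < m.+1) \sum_(0 <= b < m.+1) X b j).
  rewrite big_mkord; apply: eq_bigr => j _; rewrite big_mkord.
  rewrite (big_ord_widen m.+1 (fun b => X b j))// [LHS]big_mkcond /=.
  by apply: eq_bigr => b _; case: ltnP => // jb; rewrite X1.
rewrite exchange_big_nat /= big_ltn// big1 ?add0r; last by move=> j _; exact: X0.
rewrite big_nat_rev /= (big_add1 _ _ 1 m.+2) /= big_nat [RHS]big_nat.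
apply: eq_bigr => c /andP[c1 cm].
rewrite add1n subSS; set b := (m.+1 - c)%N.
have bm : (b <= m.+1)%N by rewrite leq_subr.
rewrite (big_cat_nat _ bm)//= big1_seq ?add0r// => j.
by rewrite mem_index_iota => /andP[_ /X1].
Qed.

Definition polylog_psum N a (z : C) : C :=
  \sum_(k < N) z ^+ k.+1 / k.+1%:R ^+ a.

Definition coef_psum N r n : R :=
  2 / pi * \sum_(2 <= a < r.+1)
    let b := (r.+1 - a)%N in
    (-1) ^+ b * reim a (polylog_psum N a (xi ^+ n.+1)) *
    \sum_(b <= j < r)
      (stirling1 j b)%:R * (stirling2 r.-1 j)%:R * reim a.+1 (xi ^+ j).

Let realcE (p q r b : nat) :
  ((p%:R * q%:R * r%:R ^+ b : R)%:C : C) = p%:R * q%:R * r%:R ^+ b.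
Proof. by rewrite !rmorphM rmorphXn !rmorph_nat. Qed.

Lemma Im_iter_diff n k m : (2 <= n)%N -> (1 <= k)%N ->
  Im ((-1) ^+ m * fiter n k m xi - giter n k m xi) =
  - 2 * (-1) ^+ k * \sum_(j < m.+1) \sum_(b < j.+1)
     (-1) ^+ b * (stirling1 j b)%:R * (stirling2 m j)%:R * k%:R ^+ b *
     (reim (m.+2 - b) ((xi ^+ n.+1) ^+ k) * reim (m.+2 - b).+1 (xi ^+ j)).
Proof.
move=> n2 k1; rewrite fiter_xi3// giter_xi3//.
set zk := (xi ^+ n.+1) ^+ k.
have e : (-1) ^+ m * ((-1) ^+ k * zk * (\sum_(j < m.+1) (stirling2 m j)%:R * (rising k%:R j * conjc (xi ^+ j)))) -
  (-1) ^+ k * zk * (\sum_(j < m.+1) (stirling2 m j)%:R * (rising (- k%:R) j * xi ^+ j)) =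
  ((-1) ^+ k : R)%:C * \sum_(j < m.+1) \sum_(b < j.+1)
    ((stirling1 j b)%:R * (stirling2 m j)%:R * k%:R ^+ b : R)%:C *
     (zk * ((-1) ^+ m * conjc (xi ^+ j) - (-1) ^+ b * xi ^+ j)).
  have -> : ((-1) ^+ k : R)%:C = (-1) ^+ k :> C by rewrite rmorphXn rmorphN rmorph1.
  set S1 := \sum_(j < m.+1) (_ * (rising k%:R j * _)).
  set S2 := \sum_(j < m.+1) (_ * (rising (- k%:R) j * _)).
  transitivity ((-1) ^+ k * (zk * ((-1) ^+ m * S1 - S2))); first by ring.
  congr (_ * _); rewrite /S1 /S2 mulr_sumr -sumrB mulr_sumr.
  apply: eq_bigr => j _; rewrite !rising_stirling1 !mulr_suml !mulr_sumr -sumrB mulr_sumr.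
  apply: eq_bigr => b _; rewrite realcE.
  by rewrite [(- k%:R) ^+ b]exprNn; ring.
rewrite e [Im _](@reimZ 1) -[X in _ = X]mulrA mulrCA; congr (_ * _).
rewrite [reim _ _](@reim_sum 1) mulr_sumr; apply: eq_bigr => j _.
rewrite [reim _ _](@reim_sum 1) mulr_sumr; apply: eq_bigr => b _.
rewrite (@reimZ 1) [reim 1 _](@Im_reim (m.+2 - b) b m); first by ring.
by rewrite subnK// (leq_trans (ltnW (ltn_ord b)))// (leq_trans (ltn_ord j)).
Qed.

(** The sign [(-1)^k] of the logarithmic series cancels the one that comes from
   [1 + xi = - xi^2], and [k^b / (k (n k)^(m+1)) = 1 / (k^a n^(m+1))] for
   [a + b = m + 2]. *)
Lemma Delta_term n k M : (2 <= n)%N ->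
  (-1) ^+ k / k.+1%:R * ((Im (fsum n k.+1 M xi) - Im (gsum n k.+1 M xi)) / pi) =
  \sum_(m < M) (2 / pi * \sum_(2 <= a < m.+2)
    let b := (m.+2 - a)%N in
    (-1) ^+ b * reim a ((xi ^+ n.+1) ^+ k.+1 / k.+1%:R ^+ a) *
    \sum_(b <= j < m.+1)
      (stirling1 j b)%:R * (stirling2 m j)%:R * reim a.+1 (xi ^+ j)) / n%:R ^+ m.+1.
Proof.
move=> n2.
have n0 : n%:R != 0 :> R by rewrite pnatr_eq0 -lt0n (leq_trans _ n2).
have k0 : k.+1%:R != 0 :> R by rewrite pnatr_eq0.
rewrite -ImN -ImD /fsum /gsum -sumrB [Im _](@reim_sum 1) !mulr_suml mulr_sumr.
apply: eq_bigr => m _.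
have -> : (-1) ^+ m / (n * k.+1)%:R ^+ m.+1 * fiter n k.+1 m xi -
   1 / (n * k.+1)%:R ^+ m.+1 * giter n k.+1 m xi =
   (((n * k.+1)%:R ^+ m.+1)^-1 : R)%:C * ((-1) ^+ m * fiter n k.+1 m xi - giter n k.+1 m xi).
  by rewrite fmorphV rmorphXn rmorph_nat; ring.
rewrite (@reimZ 1) [reim 1 _]Im_iter_diff//.
rewrite (@sum_antidiagonal _ m (fun b j => (-1) ^+ b * (stirling1 j b)%:R * (stirling2 m j)%:R *
    k.+1%:R ^+ b * (reim (m.+2 - b) ((xi ^+ n.+1) ^+ k.+1) * reim (m.+2 - b).+1 (xi ^+ j)))); last 2 first.
- by move=> b j jb; rewrite stirling1_gt// !(mulr0, mul0r).
- case=> [|j]; last by rewrite !(mulr0, mul0r).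
  case: (nat_of_ord m) => [|m']; last by rewrite /= !(mulr0, mul0r).
  by rewrite /reim /= !mulr0.
transitivity ((2 / pi) * (\sum_(2 <= a < m.+2) \sum_(m.+2 - a <= j < m.+1)
   k.+1%:R ^- m.+2 * ((-1) ^+ (m.+2 - a) * (stirling1 j (m.+2 - a))%:R * (stirling2 m j)%:R *
    k.+1%:R ^+ (m.+2 - a) * (reim (m.+2 - (m.+2 - a)) ((xi ^+ n.+1) ^+ k.+1) *
     reim (m.+2 - (m.+2 - a)).+1 (xi ^+ j)))) / n%:R ^+ m.+1).
  under [in RHS]eq_bigr do rewrite -mulr_sumr.
  rewrite -mulr_sumr; set S := \sum_(2 <= a < m.+2) _.
  rewrite natrM exprMn [(-1) ^+ k.+1]exprS [k.+1%:R ^+ m.+2]exprS.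
  have e : (-1) ^+ k * (-1) ^+ k = 1 :> R by rewrite -expr2 sqrr_sign.
  have p0 := lt0r_neq0 (pi_gt0 R); move: (@pi R) p0 => p p0.
  transitivity ((-1) ^+ k * (-1) ^+ k * (2 / p * (k.+1%:R^-1 / k.+1%:R ^+ m.+1 * S) / n%:R ^+ m.+1)).
    move: (expf_neq0 m.+1 n0) (expf_neq0 m.+1 k0) (k0).
    set u : R := n%:R ^+ m.+1; set v : R := k.+1%:R ^+ m.+1; set w : R := k.+1%:R.
    clearbody u v w => u0 v0 w0.
    by field; rewrite p0 u0 v0 w0.
  by rewrite e mul1r; congr (_ * _ * _ * _); rewrite invfM.
congr (_ * _ / _); rewrite !big_nat; apply: eq_bigr => a /andP[a2 am] /=.
have am2 : (a <= m.+2)%N by exact: ltnW.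
rewrite mulr_sumr; apply: eq_bigr => j _; rewrite subKn//.
have -> : (xi ^+ n.+1) ^+ k.+1 / k.+1%:R ^+ a = ((k.+1%:R ^+ a)^-1 : R)%:C * (xi ^+ n.+1) ^+ k.+1.
  by rewrite fmorphV rmorphXn rmorph_nat mulrC.
rewrite reimZ.
have -> : k.+1%:R ^- m.+2 = (k.+1%:R ^+ a)^-1 * (k.+1%:R ^+ (m.+2 - a))^-1 :> R.
  by rewrite -invfM -exprD subnKC.
by field; rewrite !expf_neq0.
Qed.

Lemma Delta_psum n N M : (2 <= n)%N ->
  \sum_(k < N) (-1) ^+ k / k.+1%:R *
    ((Im (fsum n k.+1 M xi) - Im (gsum n k.+1 M xi)) / pi) =
  \sum_(m < M) coef_psum N m.+1 n / n%:R ^+ m.+1.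
Proof.
move=> n2; under eq_bigr do rewrite Delta_term//.
rewrite exchange_big /=; apply: eq_bigr => m _.
rewrite -mulr_suml; congr (_ / _); rewrite /coef_psum -mulr_sumr; congr (_ * _).
rewrite exchange_big /=; apply: eq_bigr => a _.
rewrite -mulr_suml -mulr_sumr; congr (_ * _ * _).
by rewrite -(reim_sum a).
Qed.

End Coefficients.

(** * Passage to the limit *)

Section Limits.
Context {R : realType}.
Local Notation C := R[i].
Local Notation xi := (xi3 R).

Lemma cvg_complex (s : nat -> C) (x y : R) :
  (fun n => Re (s n)) @ \oo --> x -> (fun n => Im (s n)) @ \oo --> y ->
  (s : nat -> C^o) @ \oo --> (x +i* y : C^o).
Proof.
move=> sx sy; apply/cvgrPdist_lt => -[e e'].
rewrite ltcE /= => /andP[/eqP -> e0].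
have e2 : 0 < e / 2 by rewrite divr_gt0.
move/cvgrPdist_lt : sx => /(_ _ e2) sx; move/cvgrPdist_lt : sy => /(_ _ e2) sy.
near=> n.
have hx : `|x - Re (s n)| < e / 2 by near: n.
have hy : `|y - Im (s n)| < e / 2 by near: n.
have -> : `|(x +i* y : C^o) - s n| = (normc ((x +i* y) - s n))%:C by [].
rewrite -[e +i* 0]/(e%:C) ltcR.
have -> : x +i* y - s n = (x - Re (s n))%:C + 'i * (y - Im (s n))%:C.
  by case: (s n) => a b; apply: complexP; rewrite /= ?mul0r ?mul1r; ring.
apply: le_lt_trans (le_normcD _ _) _; rewrite normcM !normc_real.
rewrite [normc 'i]/= expr0n add0r expr1n sqrtr1 mul1r; lra.
Unshelve. all: by end_near.
Qed.

Lemma cvg_inv_sqr : cvgn (series (fun j : nat => (j.+1%:R ^+ 2)^-1 : R)).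
Proof.
apply: (@series_le_cvg _ _ (fun j => 2 / j.+1%:R - 2 / j.+2%:R)).
- by move=> j; rewrite invr_ge0 exprn_ge0.
- move=> j; rewrite subr_ge0 ler_pM2l// lef_pV2 ?posrE ?ltr0n//.
  by rewrite ler_nat.
- exact: inv_sqr_telescope.
have -> : series (fun j => 2 / j.+1%:R - 2 / j.+2%:R : R) = fun n => 2 - 2 * harmonic n.
  apply/funext => n; rewrite /series /=.
  rewrite (@telescope_sumr_eq _ 0 n (fun j => - (2 / j.+1%:R)))//.
    by rewrite /harmonic /= divr1 opprK addrC.
  by move=> j _; rewrite opprK addrC.
apply/cvg_ex; exists (2 - 2 * 0); apply: cvgB; first exact: cvg_cst.
by apply: cvgMr; exact: cvg_harmonic.
Qed.

(** Real and imaginary parts converge absolutely, by comparison with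
   [1 / k^2]; this determines the complex limit that defines [polylog]. *)
Lemma cvg_reim_polylog a (z : C) : (2 <= a)%N -> normc z = 1 ->
  (fun N => reim a (polylog_psum N a z)) @ \oo --> reim a (polylog a z).
Proof.
move=> a2 z1; pose u j := z ^+ j.+1 / j.+1%:R ^+ a.
have nu j : normc (u j) <= (j.+1%:R ^+ 2)^-1.
  rewrite normcM normcX z1 expr1n mul1r normcV normcX.
  rewrite -(rmorph_nat (real_complex R)) normc_real normr_nat.
  rewrite lef_pV2 ?posrE ?exprn_gt0 ?ltr0n//.
  by rewrite ler_weXn2l// ler1n.
have cu (v : nat -> R) : (forall j, `|v j| <= normc (u j)) -> cvgn (series v).
  move=> vu; apply: normed_cvg; apply: (series_le_cvg _ _ _ cvg_inv_sqr) => j /=.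
  - exact: normr_ge0.
  - by rewrite invr_ge0 exprn_ge0.
  - exact: le_trans (vu j) (nu j).
have cR := cu _ (fun j => normc_ge_Re (u j)).
have cI := cu _ (fun j => normc_ge_Im (u j)).
have sE N : series u N = polylog_psum N a z by rewrite /series /= big_mkord.
have sR N : series (fun j => Re (u j)) N = Re (polylog_psum N a z).
  rewrite /series /= big_mkord /polylog_psum.
  by rewrite -[RHS]/(reim 0 _) reim_sum.
have sI N : series (fun j => Im (u j)) N = Im (polylog_psum N a z).
  rewrite /series /= big_mkord /polylog_psum.
  by rewrite -[RHS]/(reim 1 _) reim_sum.
have hR : (fun N => Re (polylog_psum N a z)) @ \oo --> limn (series (fun j => Re (u j))).
  by under eq_fun do rewrite -sR; exact: cR.
have hI : (fun N => Im (polylog_psum N a z)) @ \oo --> limn (series (fun j => Im (u j))).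
  by under eq_fun do rewrite -sI; exact: cI.
have -> : polylog a z = limn (series (fun j => Re (u j))) +i* limn (series (fun j => Im (u j))).
  have h : (series u : nat -> C^o) @ \oo -->
      (limn (series (fun j => Re (u j))) +i* limn (series (fun j => Im (u j))) : C^o).
    by rewrite (_ : series u = fun N => polylog_psum N a z); [exact: cvg_complex|exact/funext].
  rewrite /polylog. exact: (cvg_lim (@norm_hausdorff _ C^o) h).
by rewrite /reim; case: ifP => _.
Qed.

Lemma cvg_sumr (I : Type) (s : seq I) (P : pred I) (f : I -> nat -> R) (l : I -> R) :
  (forall i, P i -> f i @ \oo --> l i) ->
  (fun n => \sum_(i <- s | P i) f i n) @ \oo --> \sum_(i <- s | P i) l i.
Proof.
move=> fl; elim: s => [|i s IH].
  by under eq_fun do rewrite big_nil; rewrite big_nil; exact: cvg_cst.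
under eq_fun do rewrite big_cons; rewrite big_cons.
by case: ifPn => // Pi; apply: cvgD => //; exact: fl.
Qed.

Lemma cvg_coef_psum r n : (fun N => coef_psum N r n) @ \oo --> coef1xy R r n.
Proof.
rewrite /coef_psum /coef1xy; apply: cvgMr.
under eq_fun do rewrite big_nat; rewrite big_nat.
apply: cvg_sumr => a /andP[a2 _]; apply: cvgMl; apply: cvgMr.
apply: cvg_reim_polylog => //.
by rewrite normcX normc_xi3 expr1n.
Qed.

End Limits.

(** * The asymptotic expansion *)

Section Expansion.
Context {R : realType}.
Local Notation C := R[i].
Local Notation xi := (xi3 R).

Definition expansion_coef (r n : nat) : R := if (2 <= r)%N then coef1xy R r n else 0.

Lemma sum_inv_sqr_le N : \sum_(k < N) (k.+1%:R ^+ 2)^-1 <= 2 :> R.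
Proof.
suff: \sum_(k < N) (k.+1%:R ^+ 2)^-1 <= 2 - 2 / N.+1%:R :> R.
  by move=> /le_trans; apply; rewrite gerBl divr_ge0.
elim: N => [|N IH]; first by rewrite big_ord0 divr1 subrr.
rewrite big_ord_recr /=; apply: le_trans (lerD IH (inv_sqr_telescope R N)) _.
by rewrite addrA subrK.
Qed.

Lemma exists_primitives n : (2 <= n)%N -> exists F G : nat -> C -> C,
  [/\ forall k, theta half_plane (F k) (fpow n k.+1), forall k, csym (F k),
      forall k, theta whole_plane (G k) (gpow n k.+1) & forall k, csym (G k)].
Proof.
move=> n2.
have /choice[F hF] : forall k, exists F : C -> C, theta half_plane F (fpow n k.+1) /\ csym F.
  move=> k; have [F hF sF] := @primitive_ratfrac R (n * k.+1).-1 k.+1.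
  exists F; split=> //; apply: theta_eq (theta_holo hF) => x _.
  by rewrite mulrA -exprS prednK// muln_gt0 (leq_trans _ n2).
have /choice[G hG] : forall k, exists G : C -> C, theta whole_plane G (gpow n k.+1) /\ csym G.
  move=> k; have [G hG sG] := @primitive_poly R k.+1 (n.-1 * k.+1).-1.
  exists G; split=> //; apply: theta_eq (theta_holo hG) => x _.
  by rewrite mulrA -exprS prednK// muln_gt0 andbT -subn1 subn_gt0.
by exists F, G; split => k; [have [] := hF k|have [] := hF k|have [] := hG k|have [] := hG k].
Qed.

(** The estimates of the two primitives carry a factor [1 / k] and the
   logarithmic series another one, so that the errors are summable; then the
   number [N] of terms of the series tends to infinity. *)
Lemma Delta_rate n M : (2 <= n)%N ->
  `|Delta (one_x_y R) n - \sum_(m < M) expansion_coef m.+1 n / n%:R ^+ m.+1| <=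
    8 * (iterbound M)%:R / n%:R ^+ M.+1.
Proof.
move=> n2; have [F [G [hF sF hG sG]]] := exists_primitives n2.
have n0 : 0 < n%:R :> R by rewrite ltr0n (leq_trans _ n2).
have n1 : 1 <= n.-1%:R :> R by rewrite ler1n -subn1 subn_gt0.
have nE : n%:R = n.-1%:R + 1 :> R by rewrite natr1 prednK// (leq_trans _ n2).
have rhoE K k : (iterbound K)%:R / n%:R ^+ K / (n.-1 * k.+1)%:R <=
    2 * (iterbound K)%:R / n%:R ^+ K.+1 / k.+1%:R :> R.
  have h : n.-1%:R^-1 <= 2 / n%:R :> R.
    rewrite ler_pdivlMr// mulrC ler_pdivrMr ?(lt_le_trans ltr01)// nE; lra.
  rewrite natrM invfM mulrA [_ / n.-1%:R]mulrC.
  apply: (@le_trans _ _ (2 / n%:R * ((iterbound K)%:R / n%:R ^+ K) / k.+1%:R)).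
    by rewrite ler_wpM2r ?invr_ge0// ler_wpM2r// divr_ge0 ?exprn_ge0.
  by rewrite [n%:R ^+ K.+1]exprS invfM le_eqVlt; apply/orP; left; apply/eqP; ring.
pose B : R := 2 * (iterbound 0)%:R / n%:R ^+ 1.
have FB k : `|Im (F k xi)| <= B / k.+1%:R.
  have := Im_primitive_fpow n2 (ltn0Sn k) 0 (hF k) (sF k).
  by rewrite /fsum big_ord0 subr0 => /le_trans; apply; exact: rhoE.
have GB k : `|Im (G k xi)| <= B / k.+1%:R.
  have := Im_primitive_gpow n2 (ltn0Sn k) 0 (hG k) (sG k).
  by rewrite /gsum big_ord0 subr0 => /le_trans; apply; exact: rhoE.
have DS := Delta_series n2 hF sF hG sG FB GB.
pose Cst : R := 8 * (iterbound M)%:R / n%:R ^+ M.+1.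
have key N : `|Delta (one_x_y R) n - \sum_(m < M) coef_psum N m.+1 n / n%:R ^+ m.+1| <=
    6 * B / N.+1%:R + Cst.
  rewrite -Delta_psum//.
  set S2 := \sum_(k < N) _.
  apply: le_trans (ler_distD (\sum_(k < N) (-1) ^+ k / k.+1%:R *
      ((Im (F k xi) - Im (G k xi)) / pi)) _ _) _.
  apply: lerD (DS N) _; rewrite /S2 -sumrB; apply: le_trans (ler_norm_sum _ _ _) _.
  apply: (@le_trans _ _ (\sum_(k < N) (4 * (iterbound M)%:R / n%:R ^+ M.+1) * (k.+1%:R ^+ 2)^-1)).
    apply: ler_sum => k _.
    rewrite -mulrBr -mulrBl !normrM normrX normrN1 expr1n mul1r.
    rewrite normfV normr_nat normfV (gtr0_norm (pi_gt0 R)).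
    have hf := le_trans (Im_primitive_fpow n2 (ltn0Sn k) M (hF k) (sF k)) (rhoE M k).
    have hg := le_trans (Im_primitive_gpow n2 (ltn0Sn k) M (hG k) (sG k)) (rhoE M k).
    have hd : `|Im (F k xi) - Im (G k xi) - (Im (fsum n k.+1 M xi) - Im (gsum n k.+1 M xi))| <=
        4 * (iterbound M)%:R / n%:R ^+ M.+1 / k.+1%:R.
      rewrite [X in `|X|](_ : _ = (Im (F k xi) - Im (fsum n k.+1 M xi)) - (Im (G k xi) - Im (gsum n k.+1 M xi))); last by ring.
      apply: le_trans (ler_normB _ _) _; apply: le_trans (lerD hf hg) _.
      by rewrite le_eqVlt; apply/orP; left; apply/eqP; ring.
    apply: (@le_trans _ _ (k.+1%:R^-1 * (4 * (iterbound M)%:R / n%:R ^+ M.+1 / k.+1%:R))).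
      rewrite ler_wpM2l ?invr_ge0//; apply: le_trans hd.
      rewrite ler_piMr// invf_le1 ?pi_gt0//; have := pi_ge2 R; lra.
    by rewrite expr2 invfM le_eqVlt; apply/orP; left; apply/eqP; ring.
  rewrite -mulr_sumr; apply: le_trans (ler_wpM2l _ (sum_inv_sqr_le N)) _.
    by rewrite !mulr_ge0 ?invr_ge0 ?exprn_ge0.
  by rewrite /Cst le_eqVlt; apply/orP; left; apply/eqP; ring.
have c1 m : (fun N => coef_psum N m.+1 n) @ \oo --> expansion_coef m.+1 n.
  rewrite /expansion_coef; case: ltnP => m1; first exact: cvg_coef_psum.
  have -> : m = 0%N by case: m m1.
  by rewrite /coef_psum; under eq_fun do rewrite big_geq// mulr0; exact: cvg_cst.
have c2 : (fun N => `|Delta (one_x_y R) n - \sum_(m < M) coef_psum N m.+1 n / n%:R ^+ m.+1|) @ \oo -->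
   `|Delta (one_x_y R) n - \sum_(m < M) expansion_coef m.+1 n / n%:R ^+ m.+1|.
  apply: cvg_norm; apply: cvgB; first exact: cvg_cst.
  by apply: cvg_sumr => m _; apply: cvgMl; exact: c1.
have c3 : (fun N => 6 * B / N.+1%:R + Cst) @ \oo --> (6 * B * 0 + Cst : R).
  apply: cvgD; last exact: cvg_cst.
  by apply: cvgMr; exact: cvg_harmonic.
rewrite mulr0 add0r in c3.
by apply: (ler_cvg_to c2 c3); apply: nearW.
Qed.

(** ** Dependence on [n] through its residue modulo three *)

Lemma xi3_mod n : xi ^+ n = xi ^+ (n %% 3).
Proof. by rewrite {1}(divn_eq n 3) exprD mulnC exprM xi3_cube expr1n mul1r. Qed.

Lemma expi_nat (a : R) n : expi (a * n%:R) = expi a ^+ n.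
Proof.
elim: n => [|n IH]; first by rewrite mulr0 expi0.
by rewrite -natr1 mulrDr mulr1 expiD IH exprSr.
Qed.

(** A constant, a cosine and a sine of period three interpolate the three
   values; at an integer the last two are the real and imaginary parts of a
   power of [xi]. *)
Lemma quasiperiodic_mod3 (c : nat -> R) : (forall n, c n = c (n %% 3)%N) ->
  exists2 w : R -> R, quasiperiodic w & forall n, c n = w n%:R.
Proof.
move=> c3.
pose al := (c 0 + c 1%N + c 2) / 3.
pose be := c 0 - al.
pose ga := (c 1%N - c 2) / Num.sqrt 3.
pose w (x : R) := al + be * cos (2 * pi / 3 * x) + ga * sin (2 * pi / 3 * x).
have s3 : Num.sqrt 3 != 0 :> R by rewrite gt_eqF// sqrtr_gt0.
exists w.
  exists 1, (fun=> w); split=> [_|x]; last by rewrite big_ord1.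
  split.
    move=> x; apply: cvgD; first apply: cvgD; first exact: cvg_cst.
      apply: cvgMr; apply: (@cvg_comp _ _ _ (fun x => 2 * pi / 3 * x) (@cos R)); last exact: continuous_cos.
      by apply: cvgMr; exact: cvg_id.
    apply: cvgMr; apply: (@cvg_comp _ _ _ (fun x => 2 * pi / 3 * x) (@sin R)); last exact: continuous_sin.
    by apply: cvgMr; exact: cvg_id.
  exists 3 => // x; rewrite /w.
  have -> : 2 * pi / 3 * (x + 3) = 2 * pi / 3 * x + pi *+ 2 :> R.
    by rewrite mulr2n; field.
  by rewrite cosD2pi sinD2pi.
move=> n; rewrite c3.
have -> : w n%:R = al + be * Re (xi ^+ (n %% 3)) + ga * Im (xi ^+ (n %% 3)).
  by rewrite -xi3_mod -expi_nat.
have : (n %% 3 < 3)%N by rewrite ltn_mod.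
have s2 : Num.sqrt 3 ^+ 2 = 3 :> R := sqrt3_sq.
have x2 : xi ^+ 2 = - (1 + xi) by rewrite one_xi3 opprK.
case: (n %% 3)%N => [|[|[|]]] // _.
- by rewrite expr0 /= mulr1 mulr0 addr0 /be addrC subrK.
- by rewrite expr1 Re_xi3 Im_xi3 /be /ga /al; field.
- by rewrite x2 ReN ImN ReD ImD Re_xi3 Im_xi3 /= /be /ga /al; field.
Qed.

(** ** Integrality of the coefficients *)

Definition Zsqrt3 (x : R) := exists u v : int, x = u%:~R + v%:~R * Num.sqrt 3.

Lemma Zsqrt3D x y : Zsqrt3 x -> Zsqrt3 y -> Zsqrt3 (x + y).
Proof.
move=> [u [v ->]] [u' [v' ->]]; exists (u + u'), (v + v').
by rewrite !rmorphD /=; ring.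
Qed.

Lemma Zsqrt3Z (m : int) x : Zsqrt3 x -> Zsqrt3 (m%:~R * x).
Proof.
move=> [u [v ->]]; exists (m * u), (m * v).
by rewrite !rmorphM /=; ring.
Qed.

Lemma Zsqrt3_sum (I : Type) (s : seq I) (f : I -> R) :
  (forall i, Zsqrt3 (f i)) -> Zsqrt3 (\sum_(i <- s) f i).
Proof.
move=> h; elim: s => [|i s IH]; first by rewrite big_nil; exists 0, 0; rewrite mul0r addr0.
by rewrite big_cons; exact: Zsqrt3D.
Qed.

Lemma Zsqrt3_reim a j : Zsqrt3 (2 * reim a (xi ^+ j)).
Proof.
rewrite xi3_mod; have : (j %% 3 < 3)%N by rewrite ltn_mod.
have x2 : xi ^+ 2 = - (1 + xi) by rewrite one_xi3 opprK.
case: (j %% 3)%N => [|[|[|]]] // _; rewrite /reim; case: ifP => _.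
- by exists 0, 0; rewrite /= mulr0 mul0r addr0.
- by exists 2, 0; rewrite /= mulr1 mul0r addr0.
- by exists 0, 1; rewrite expr1 Im_xi3; field.
- by exists (-1), 0; rewrite expr1 Re_xi3; field.
- by exists 0, (-1); rewrite x2 ImN ImD Im_xi3 /=; field.
- by exists (-1), 0; rewrite x2 ReN ReD Re_xi3 /=; field.
Qed.

(** The factor [2 / pi] is [4 / (2 pi)], and [4 = 2 * 2] clears the denominator
   two of the real and imaginary parts of the powers of [xi]. *)
Lemma coef1xy_polylog_combination r n : (2 <= r)%N -> polylog_combination (coef1xy R r n).
Proof.
move=> r2.
pose q a : R := 2 / pi * ((-1) ^+ (r.+1 - a) *
   \sum_(r.+1 - a <= j < r) (stirling1 j (r.+1 - a))%:R * (stirling2 r.-1 j)%:R * reim a.+1 (xi ^+ j)).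
exists [seq (q a, a, xi ^+ n.+1) | a <- index_iota 2 r.+1].
  move=> q' a' z /mapP[a]; rewrite mem_index_iota => /andP[a2 _] [-> -> ->].
  split => //; last by rewrite -exprM mulnC exprM xi3_cube expr1n.
  suff [u [v e]] : Zsqrt3 (4 * ((-1) ^+ (r.+1 - a) *
     \sum_(r.+1 - a <= j < r) (stirling1 j (r.+1 - a))%:R * (stirling2 r.-1 j)%:R * reim a.+1 (xi ^+ j))).
    exists u, v; rewrite -e /q.
    by move: (@pi R) (lt0r_neq0 (pi_gt0 R)) => p p0; field.
  have -> : 4 * ((-1) ^+ (r.+1 - a) *
     \sum_(r.+1 - a <= j < r) (stirling1 j (r.+1 - a))%:R * (stirling2 r.-1 j)%:R * reim a.+1 (xi ^+ j)) =
     \sum_(r.+1 - a <= j < r) (2 * (-1) ^+ (r.+1 - a) * (stirling1 j (r.+1 - a))%:Z * (stirling2 r.-1 j)%:Z)%:~R *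
        (2 * reim a.+1 (xi ^+ j)) :> R.
    rewrite !mulr_sumr; apply: eq_bigr => j _.
    by rewrite !rmorphM rmorphXn rmorphN /= rmorph1; ring.
  by apply: Zsqrt3_sum => j; apply: Zsqrt3Z; exact: Zsqrt3_reim.
rewrite big_map /coef1xy mulr_sumr; apply: eq_bigr => a _ /=.
by rewrite /q; ring.
Qed.

Lemma coef1xy_mod3 r n : coef1xy R r n = coef1xy R r (n %% 3)%N.
Proof. by rewrite /coef1xy (xi3_mod n.+1) (xi3_mod (n %% 3).+1) -[n.+1]addn1 -[(n %% 3).+1]addn1 modnDml. Qed.

End Expansion.

Theorem corollary2 (R : realType) :
  pseudo_expansion (Delta (one_x_y R))
    (fun r n => if (2 <= r)%N then coef1xy R r n else 0) /\
  (forall r n : nat, (2 <= r)%N -> polylog_combination (coef1xy R r n)).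
Proof.
split; last by move=> r n; exact: coef1xy_polylog_combination.
split=> [r|[//|M] _].
  by apply: quasiperiodic_mod3 => n; rewrite coef1xy_mod3.
pose err n := `|Delta (one_x_y R) n - \sum_(r < M.+1) expansion_coef r n / n%:R ^+ r|.
exists (8 * (iterbound M)%:R + err 1%N) => n n0.
rewrite -[X in X <= _]/(err n).
have e1 : 0 <= err 1%N by exact: normr_ge0.
have [n2|n1] := leqP 2 n; last first.
  have -> : n = 1%N by case: n n0 n1 => [|[|]].
  by rewrite expr1n divr1 lerDr mulr_ge0.
apply: (@le_trans _ _ (8 * (iterbound M)%:R / n%:R ^+ M.+1)); last first.
  by rewrite ler_wpM2r ?invr_ge0 ?exprn_ge0// lerDl.
rewrite /err big_ord_recl {1}/expansion_coef /= mul0r add0r.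
exact: Delta_rate.
Qed.
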